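(* Let $\mathbb{E}$ be a separable Banach space and let $\mu \in \mathcal{P}(\mathbb{E})$ be a nontrivial weakly stable measure, i.e. $\mu$ is weakly stable and $\mu \neq \delta_0$. Then for all $\lambda, \lambda_1, \lambda_2, \lambda_3 \in \mathcal{P}$ and all $a \in \mathbb{R}$ the following hold, where in (2)-(5), if $\mu$ is symmetric, each equality $\nu_1=\nu_2$ between measures on $\mathbb{R}$ is understood as $|\nu_1|=|\nu_2|$: (1) $\lambda_1 \oplus_\mu \lambda_2$ is uniquely determined (that is, the measure assigned to the pair $\lambda_1,\lambda_2$ by the definition of $\oplus_\mu$ does not depend on the choice of the measure $\lambda$ in that definition); (2) $\lambda_1 \oplus_\mu \lambda_2 = \lambda_2 \oplus_\mu \lambda_1$; (3) $\lambda \oplus_\mu \delta_0 = \lambda$; (4) $(\lambda_1 \oplus_\mu \lambda_2) \oplus_\mu \lambda_3 = \lambda_1 \oplus_\mu (\lambda_2 \oplus_\mu \lambda_3)$; (5) $T_a(\lambda_1 \oplus_\mu \lambda_2) = (T_a\lambda_1) \oplus_\mu (T_a\lambda_2)$.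
   Context: $\mathcal{P}(\mathbb{E})$ is the set of all Borel probability measures on $\mathbb{E}$, and $\mathcal{P} = \mathcal{P}(\mathbb{R})$. For $a \in \mathbb{R}$ and a probability measure $\nu$, $T_a\nu$ is the distribution of $aX$ when $X$ has distribution $\nu$ (so $T_0\nu=\delta_0$). For $\mu \in \mathcal{P}(\mathbb{E})$ and $\lambda \in \mathcal{P}$, the scale mixture is $(\mu \circ \lambda)(A) = \int_{\mathbb{R}} T_s\mu(A)\,\lambda(ds)$ for Borel $A \subset \mathbb{E}$, also written $\lambda\circ\mu$; it is the distribution of $\mathbf{X}\Theta$, where $\mathbf{X}\sim\mu$ and $\Theta\sim\lambda$ are independent. The symbol $*$ denotes ordinary convolution. For $\lambda \in \mathcal{P}$, $|\lambda|$ denotes the distribution of $|\Theta|$ when $\Theta \sim \lambda$. A measure $\mu \in \mathcal{P}(\mathbb{E})$ is weakly stable if for all $\lambda_1,\lambda_2 \in \mathcal{P}$ there exists $\lambda \in \mathcal{P}$ such that $(\lambda_1\circ\mu)*(\lambda_2\circ\mu)=\lambda\circ\mu$. A measure $\mu$ is symmetric if $T_{-1}\mu=\mu$. Generalized convolution: let $\mu \neq \delta_0$ be weakly stable and $\lambda_1,\lambda_2\in\mathcal{P}$. If $\lambda\in\mathcal{P}$ satisfies $(\lambda_1\circ\mu)*(\lambda_2\circ\mu)=\lambda\circ\mu$, then $\lambda_1\oplus_\mu\lambda_2 := \lambda$ if $\mu$ is not symmetric, and $\lambda_1\oplus_\mu\lambda_2 := |\lambda|$ if $\mu$ is symmetric.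 *)

(* Defs.v *)
From HB Require Import structures.
From mathcomp Require Import all_boot all_order all_algebra.
From mathcomp Require Import all_classical all_reals all_analysis.
From mathcomp Require Import measurable_realfun.

Set Implicit Arguments.
Unset Strict Implicit.
Unset Printing Implicit Defensive.

Import Order.TTheory GRing.Theory Num.Theory.
Import numFieldNormedType.Exports.

Local Open Scope classical_set_scope.
Local Open Scope ring_scope.

Definition separable (T : topologicalType) : Prop :=
  exists2 D : set T, countable D & dense D.

(* E with its Borel sigma-algebra. On the scalar field R, the library's
   canonical sigma-algebra is already the Borel one. *)
Notation borel E := (g_sigma_algebraType (@open E)).

(* A measure in the library is a function defined on all sets, whose values on
   non-measurable sets are irrelevant: equality of measures is equality on the
   measurable sets. *)
Definition eq_measure d (T : measurableType d) (R : realType)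
    (nu1 nu2 : set T -> \bar R) : Prop :=
  forall A : set T, measurable A -> nu1 A = nu2 A.

Notation "nu1 ≡ nu2" := (eq_measure nu1 nu2) (at level 70, no associativity).

Definition law d d' (T : measurableType d) (T' : measurableType d')
    (R : realType) (P : probability T R) (f : T -> T')
    (mf : measurable_fun [set: T] f) : probability T' R :=
  distribution P (HB.pack_for {mfun T >-> T'} f (isMeasurableFun.Build _ _ _ _ f mf)).

Lemma law_pushforward d d' (T : measurableType d) (T' : measurableType d')
    (R : realType) (P : probability T R) (f : T -> T')
    (mf : measurable_fun [set: T] f) :
  law P mf = pushforward P f :> (set T' -> \bar R).
Proof. by []. Qed.

Section scaling_measurable.
Context (R : realType) (E : completeNormedModType R).

Lemma continuous_borel (f : E -> E) : continuous f ->
  measurable_fun [set: borel E] (f : borel E -> borel E).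
Proof.
move=> cf; apply: (@measurability _ _ (borel E) (borel E) _ _ (@open E)) => //.
move=> _ [U oU <-]; rewrite setTI; apply: sub_sigma_algebra.
by move/continuousP : cf; apply.
Qed.

Lemma measurable_scale (a : R) :
  measurable_fun [set: borel E] (( *:%R a : E -> E) : borel E -> borel E).
Proof. by apply: continuous_borel; exact: scaler_continuous. Qed.

Lemma measurable_scale_pair :
  measurable_fun [set: R * borel E]
    ((fun z => z.1 *: z.2) : R * borel E -> borel E).
Proof.
apply: (@measurability _ _ _ (borel E) _ _ (@open E)) => //.
move=> _ [U oU <-]; rewrite setTI.
pose V k := [set y : E | ball y k.+1%:R^-1 `<=` U]°.
have mV q k : measurable ((fun x : borel E => ratr q *: (x : E)) @^-1` V k).
  have := measurable_scale (ratr q) measurableT.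
  move=> /(_ (V k)); rewrite setTI; apply.
  by apply: sub_sigma_algebra; exact: open_interior.
suff -> : (fun z : R * borel E => z.1 *: (z.2 : E)) @^-1` U =
    \bigcup_k \bigcap_n \bigcup_(q : rat) (ball (ratr q : R) n.+1%:R^-1 `*`
      ((fun x : borel E => ratr q *: (x : E)) @^-1` V k)).
  apply: bigcupT_measurable => k; apply: bigcapT_measurable => n.
  apply: bigcupT_measurable_rat => q.
  apply: measurableX; last exact: mV.
  by apply: open_measurable; exact: ball_open.
apply/seteqP; split => [[s x] /= Usx|[s x] [k _ Hk] /=]; last first.
  have [n nx] : exists n : nat, n.+1%:R^-1 * `|x : E| < k.+1%:R^-1 :> R.
    have kx : 0 < k.+1%:R^-1 / (`|x : E| + 1) :> R.
      by rewrite divr_gt0// ltr_wpDl.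
    have [n _ /(_ n (leqnn n)) hn] := near_infty_natSinv_lt (PosNum kx).
    exists n; rewrite /= ltr_pdivlMr ?ltr_wpDl// in hn.
    by apply: le_lt_trans hn; rewrite ler_wpM2l// lerDl.
  have [q _ [/= sq /interior_subset Vq]] := Hk n I.
  apply: Vq; rewrite -ball_normE /= -scalerBl normrZ; apply: le_lt_trans nx.
  by apply: ler_wpM2r => //; apply: ltW; move: sq; rewrite -ball_normE.
have [_/posnumP[e] eU] : nbhs_ball (s *: x : E) U.
  by apply/nbhs_ballP; exact: open_nbhs_nbhs.
have [k ke] : exists k : nat, k.+1%:R^-1 < e%:num / 2 :> R.
  have [k _ /(_ k (leqnn k)) hk] := near_infty_natSinv_lt (e%:num / 2)%:pos.
  by exists k.
exists k => // n _.
have W : nbhs s ((fun r : R => r *: (x : E)) @^-1` ball (s *: (x : E)) (e%:num / 2)).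
  by apply: scalel_continuous; exact: nbhsx_ballx.
have [_/posnumP[e'] e'W] := (nbhs_ballP _ _).1 W.
pose m : R := Num.min e'%:num n.+1%:R^-1.
have m0 : 0 < m by rewrite lt_min invr_gt0 ltr0n andbT.
have [w [sq [q _ qE]]] := @dense_rat R (ball s m)
  (ex_intro _ s (ballxx s m0)) (ball_open _ _).
move: sq; rewrite -qE => sq.
exists q => //; split => /=.
  by apply/ball_sym/(le_ball _ sq); rewrite ge_min lexx orbT.
have /e'W qe : ball s e'%:num (ratr q : R).
  by apply: (le_ball _ sq); rewrite ge_min lexx.
apply/nbhs_ballP.
exists (e%:num / 2 - `|s *: (x : E) - ratr q *: (x : E)|) => /=.
  by rewrite subr_gt0; move: qe; rewrite /preimage /= -ball_normE.
move=> y; rewrite -ball_normE/= ltrBrDl => qy z; rewrite /= => yz.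
apply: eU; rewrite -ball_normE/=.
have -> : s *: (x : E) - z =
    (s *: (x : E) - ratr q *: (x : E) + (ratr q *: (x : E) - y)) + (y - z).
  by rewrite !subrKA.
apply: le_lt_trans (ler_normD _ _) _; rewrite [ltRHS]splitr ltrD//.
  by apply: le_lt_trans (ler_normD _ _) _.
exact: lt_trans yz ke.
Qed.

End scaling_measurable.

Section weak_stability.
Context (R : realType) (E : completeNormedModType R).
Implicit Types (mu : probability (borel E) R) (lam : probability R R).

(* T_a mu on E; for a = 0 this is the Dirac measure at 0. *)
Definition scale mu (a : R) : probability (borel E) R :=
  law mu (@measurable_scale R E a).

(* T_a lam on the real line. *)
Definition scaleR (a : R) lam : probability R R :=
  law lam (@mulrl_measurable R [set: R] a).

Definition abs_law lam : probability R R :=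
  law lam (@normr_measurable R [set: R]).

Definition scale_mixture mu lam : set (borel E) -> \bar R :=
  fun A => (\int[lam]_s scale mu s A)%E.

Lemma scale_mixture_law mu lam :
  scale_mixture mu lam = law (lam \x mu)%E (@measurable_scale_pair R E).
Proof.
apply/funext => A; rewrite law_pushforward /pushforward /product_measure1.
apply: eq_integral => s _ /=; rewrite /scale law_pushforward /pushforward.
by congr (mu _); apply/seteqP; split => x; rewrite /xsection/= inE.
Qed.

Section scale_mixture_probability.
Variables (mu : probability (borel E) R) (lam : probability R R).

Let scale_mixture0 : scale_mixture mu lam set0 = 0%E.
Proof. by rewrite scale_mixture_law measure0. Qed.

Let scale_mixture_ge0 A : (0 <= scale_mixture mu lam A)%E.
Proof. by rewrite scale_mixture_law measure_ge0. Qed.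

Let scale_mixture_sigma_additive : semi_sigma_additive (scale_mixture mu lam).
Proof. by rewrite scale_mixture_law; exact: measure_semi_sigma_additive. Qed.

HB.instance Definition _ := isMeasure.Build _ _ _ (scale_mixture mu lam)
  scale_mixture0 scale_mixture_ge0 scale_mixture_sigma_additive.

Let scale_mixture_setT : scale_mixture mu lam [set: _] = 1%E.
Proof. by rewrite scale_mixture_law probability_setT. Qed.

HB.instance Definition _ := Measure_isProbability.Build _ _ _
  (scale_mixture mu lam) scale_mixture_setT.

End scale_mixture_probability.

(* The law of the sum of two independent vectors with laws m1 and m2. It is not
   bundled as a probability because measurability of addition for the product
   sigma-algebra relies on the separability of E. *)
Definition convolution (m1 m2 : probability (borel E) R) :
    set (borel E) -> \bar R :=
  pushforward (m1 \x m2)%E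
    ((fun z => z.1 + z.2) : borel E * borel E -> borel E).

(* (lam1 o mu) * (lam2 o mu) = lam o mu *)
Definition mixture_factor mu lam1 lam2 lam : Prop :=
  convolution (scale_mixture mu lam1) (scale_mixture mu lam2)
    ≡ scale_mixture mu lam.

Definition weakly_stable mu : Prop :=
  forall lam1 lam2, exists lam, mixture_factor mu lam1 lam2 lam.

Definition symmetric_law mu : Prop := scale mu (-1) ≡ mu.

(* The reduction lam |-> |lam| that is applied only when mu is symmetric. *)
Definition fold_law mu lam : probability R R :=
  if pselect (symmetric_law mu) then abs_law lam else lam.

(* lam1 (+)_mu lam2; the mixing measure is picked by choice among all those
   provided by weak stability. *)
Definition gconv mu (ws : weakly_stable mu) lam1 lam2 : probability R R :=
  fold_law mu (projT1 (cid (ws lam1 lam2))).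

End weak_stability.

(* Main.v *)
Require Import Defs.
From mathcomp Require Import all_boot all_order all_algebra.
From mathcomp Require Import all_classical all_reals all_analysis.
From mathcomp Require Import measurable_realfun ring lra.

(** The idea is to cancel mu from an equality lam o mu = lam' o mu by means of
    an algebra of functions of the scale. Fix a continuous linear functional xi
    and let phi be the characteristic function of xi(X), where X has law mu. The
    characteristic function of the mixture kap o mu, read along xi, is
    phi_kap(s) = \int phi(s t) kap(dt). Weak stability says that the product of
    phi_kap1 with phi_kap2, or with its complex conjugate, is again some
    phi_kap3, so the real and imaginary parts of the functions phi_kap span an
    algebra of bounded functions on the real line
    (mixture_transforms_mul_closed). By Fubini, the integral of phi_kap under lam
    is the integral of phi_lam under kap; if lam o mu = lam' o mu, then lam and
    lam' agree on this algebra, hence, by a monotone class theorem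
    (eq_measure_lin_span), on the sigma-algebra that it generates
    (eq_sigma_mixture_transforms).

    This sigma-algebra is large. The functions s |-> phi(t s) belong to the
    algebra, and they take the same values at s and s' for all t only if
    |s| = |s'|, since otherwise phi(t) = phi(r t) with |r| < 1, which makes phi
    constant. If phi is not real, they also separate s from - s. Since the
    functions are continuous, compactness shows that the intervals [-b, b], and
    in the second case all compact intervals, lie in the sigma-algebra
    (separated_itv_sigma). So |lam| = |lam'| in general (eq_abs_law), and
    lam = lam' if phi is not real (eq_law_of_asymmetric).

    It remains to find a functional for which phi is nonconstant, and not real
    unless mu is symmetric (exists_resolving_functional). One exists because a
    Borel probability measure on a separable Banach space is determined by its
    characteristic functional (eq_measure_char_functional), which follows from the
    same monotone class theorem, applied to the trigonometric functions of
    functionals, because by the Hahn-Banach theorem countably many functionals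
    recover the norm, hence the balls.

    The five properties are then identities between characteristic functions
    along xi: that of lam1 (+) lam2 is the product of those of lam1 and lam2, that
    of T_a lam is s |-> phi_lam(a s), that of the Dirac mass at 0 is 1, and passing
    from lam to |lam| does not change phi_lam when mu is symmetric.
    Characteristic functions are handled as pairs of cosine and sine
    transforms. *)

Set Implicit Arguments.
Unset Strict Implicit.
Unset Printing Implicit Defensive.
Import Order.TTheory GRing.Theory Num.Theory.
Import numFieldNormedType.Exports.
Local Open Scope classical_set_scope.
Local Open Scope ring_scope.

(** * The Hahn-Banach theorem for sublinear functionals *)
Section hahn_banach.
Context (R : realType) (V : lmodType R).
Implicit Types p q : V -> R.

Definition sublinear p := (forall x y, p (x + y) <= p x + p y) /\
  (forall a x, 0 <= a -> p (a *: x) = a * p x).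

Lemma sublinear_of_superhomogeneous p : p 0 = 0 ->
  (forall x y, p (x + y) <= p x + p y) ->
  (forall a x, 0 < a -> a * p x <= p (a *: x)) -> sublinear p.
Proof.
move=> p0 pD pZ; split=> // a x; rewrite le_eqVlt => /predU1P[<-|a0].
  by rewrite scale0r mul0r.
apply/eqP; rewrite eq_le pZ// andbT -ler_pdivrMl//.
by apply: le_trans (pZ _ _ _) _; rewrite ?invr_gt0// scalerA mulVf ?gt_eqF// scale1r.
Qed.

Lemma sublinear0 p : sublinear p -> p 0 = 0.
Proof. by move=> [_ pZ]; have := pZ 0 0 (lexx _); rewrite scaler0 mul0r. Qed.

Lemma sublinear_ge p x : sublinear p -> - p (- x) <= p x.
Proof.
move=> sp; rewrite lerNl -subr_ge0 opprK addrC -(sublinear0 sp) -[in leLHS](subrr x).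
exact: sp.1.
Qed.

(** The infimum of p (x + t y) - t p(y) over t >= 0 is sublinear because the
    parameters t add up when two points are added; t = 1 gives the bound at
    - y. A minimal p is therefore odd, and this also creates the functional
    below p that takes the value p y at y. *)
Lemma sublinear_shear p y : sublinear p ->
  exists q, [/\ sublinear q, forall x, q x <= p x & q (- y) <= - p y].
Proof.
move=> sp; have [pD pZ] := sp.
pose S x := [set p (x + t *: y) - t * p y | t in [set t | 0 <= t]].
have Slb x : lbound (S x) (- p (- x)).
  move=> _ [t /= t0 <-]; rewrite lerBrDr -pZ// addrC lerBlDr.
  by apply: le_trans (pD _ _); rewrite addrAC subrr add0r.
have Sle x t : 0 <= t -> inf (S x) <= p (x + t *: y) - t * p y.
  by move=> t0; apply: ge_inf; [exists (- p (- x))|exists t].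
have leS x c : (forall t, 0 <= t -> c <= p (x + t *: y) - t * p y) -> c <= inf (S x).
  move=> h; apply: lb_le_inf; first by exists (p (x + 0 *: y) - 0 * p y); exists 0 => /=.
  by move=> _ [t /= t0 <-]; exact: h.
exists (fun x => inf (S x)); split.
- apply: sublinear_of_superhomogeneous.
  + apply/eqP; rewrite eq_le; apply/andP; split.
      by apply: le_trans (Sle _ 0 _) _; rewrite // scale0r addr0 mul0r subr0 sublinear0.
    by apply: (leS) => t t0; rewrite add0r pZ// subrr.
  + move=> x z /=; rewrite -lerBlDr; apply: (leS) => t t0.
    rewrite lerBlDr -lerBlDl; apply: (leS) => u u0; rewrite lerBlDl.
    apply: le_trans (Sle _ (t + u) _) _; first exact: addr_ge0.
    rewrite scalerDl addrACA mulrDl.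
    by have := pD (x + t *: y) (z + u *: y); lra.
  + move=> a x a0 /=; apply: (leS) => t t0; rewrite -ler_pdivlMl//.
    apply: le_trans (Sle _ (t / a) _) _; first by rewrite divr_ge0// ltW.
    have -> : a *: x + t *: y = a *: (x + (t / a) *: y).
      by rewrite scalerDr scalerA mulrCA divff ?gt_eqF// mulr1.
    rewrite (pZ _ _ (ltW a0)) mulrBr mulrA mulVf ?gt_eqF// mul1r.
    by rewrite mulrA (mulrC a^-1).
- move=> x; apply: le_trans (Sle _ 0 _) _ => //.
  by rewrite scale0r addr0 mul0r subr0.
- apply: le_trans (Sle _ 1 _) _ => //.
  by rewrite scale1r addNr sublinear0// mul1r sub0r.
Qed.

(** Zorn's lemma for the reversed pointwise order: the infimum of a chain of
    sublinear functionals is sublinear, since the smaller of two members of the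
    chain bounds both terms of a sum. *)
Lemma minimal_sublinear p : sublinear p -> exists q, [/\ sublinear q,
  forall x, q x <= p x & forall r, sublinear r -> (forall x, r x <= q x) -> r = q].
Proof.
move=> sp; pose T := {q | sublinear q /\ forall x, q x <= p x}.
pose mk q (h : sublinear q /\ forall x, q x <= p x) : T := exist _ q h.
pose le (q r : T) := `[< forall x, sval r x <= sval q x >].
have [||||[q [sq qp]] qmin] := @Zorn T le.
- by move=> q; apply/asboolP.
- move=> q r s /asboolP qr /asboolP rs; apply/asboolP => x.
  exact: le_trans (rs x) (qr x).
- move=> [q Pq] [r Pr] /asboolP/= qr /asboolP/= rq.
  have qrE : q = r by apply/funext => x; apply/eqP; rewrite eq_le qr rq.
  by case: r / qrE Pr {qr rq} => Pr; congr exist; exact: Prop_irrelevance.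
- move=> A Atot; have [[q0 Aq0]|A0] := pselect (exists q : T, A q); last first.
    exists (mk p (conj sp (fun=> lexx _))) => q Aq.
    by exfalso; apply: A0; exists q.
  pose S x := [set sval (q : T) x | q in A].
  have Slb x : lbound (S x) (- p (- x)).
    move=> _ [[q [sq qp]] /= Aq <-].
    by apply: le_trans (sublinear_ge x sq); rewrite lerN2.
  have Sle x (q : T) : A q -> inf (S x) <= sval q x.
    by move=> Aq; apply: ge_inf; [exists (- p (- x))|exists q].
  have leS x c : (forall q : T, A q -> c <= sval q x) -> c <= inf (S x).
    move=> h; apply: lb_le_inf; first by exists (sval q0 x); exists q0.
    by move=> _ [q Aq <-]; exact: h.
  have sS : sublinear (fun x => inf (S x)).
    apply: sublinear_of_superhomogeneous.
    + apply/eqP; rewrite eq_le; apply/andP; split.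
        by apply: le_trans (Sle _ _ Aq0) _; rewrite (sublinear0 (svalP q0).1).
      by apply: (leS) => q _; rewrite (sublinear0 (svalP q).1).
    + move=> x z /=; rewrite -lerBlDr; apply: (leS) => q Aq.
      rewrite lerBlDr -lerBlDl; apply: (leS) => r Ar; rewrite lerBlDl.
      have [/asboolP qr|/asboolP rq] := Atot _ _ Aq Ar.
        apply: le_trans (Sle _ _ Ar) _; apply: le_trans ((svalP r).1.1 _ _) _.
        by rewrite lerD2r qr.
      apply: le_trans (Sle _ _ Aq) _; apply: le_trans ((svalP q).1.1 _ _) _.
      by rewrite lerD2l rq.
    + move=> a x a0 /=; apply: (leS) => q Aq; rewrite ((svalP q).1.2 _ _ (ltW a0)).
      by rewrite ler_pM2l// Sle.
  have Sp x : inf (S x) <= p x.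
    by apply: le_trans (Sle _ _ Aq0) _; exact: (svalP q0).2.
  exists (mk _ (conj sS Sp)) => q Aq; apply/asboolP => x /=; exact: Sle.
exists q; split=> // r sr rq.
have rp x : r x <= p x by exact: le_trans (rq x) (qp x).
have := qmin (mk r (conj sr rp)); move=> h.
by have /h/(congr1 sval) : le (mk q (conj sq qp)) (mk r (conj sr rp))
  by apply/asboolP.
Qed.

(** Shearing cannot decrease a minimal functional, so it is odd; an odd
    subadditive functional is additive. *)
Lemma minimal_sublinear_scalar q : sublinear q ->
  (forall r, sublinear r -> (forall x, r x <= q x) -> r = q) -> scalar q.
Proof.
move=> sq qmin; have [qD qZ] := sq.
have qN y : q (- y) = - q y.
  have [r [sr rq rN]] := sublinear_shear y sq.
  apply/eqP; rewrite eq_le -{1}(qmin _ sr rq) rN/=.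
  by rewrite lerNl; have := sublinear_ge y sq; lra.
have qDE x y : q (x + y) = q x + q y.
  apply/eqP; rewrite eq_le qD/= -lerBrDr -qN.
  by apply: le_trans (qD _ _); rewrite addrK.
move=> a x y; rewrite qDE; congr (_ + _).
have [a0|a0] := leP 0 a; first exact: qZ.
have na : 0 <= - a by rewrite oppr_ge0 ltW.
by rewrite -[a in LHS]opprK scaleNr qN qZ// mulNr opprK.
Qed.

(** A linear functional below the shear of p at y lies below p and satisfies
    xi (- y) <= - p y, which forces the value p y at y. *)
Theorem hahn_banach_dominated p y : sublinear p ->
  exists xi : V -> R, [/\ scalar xi, forall x, xi x <= p x & xi y = p y].
Proof.
move=> sp; have [q [sq qp qy]] := sublinear_shear y sp.
have [xi [sxi xiq /(minimal_sublinear_scalar sxi) lxi]] := minimal_sublinear sq.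
have xip x : xi x <= p x := le_trans (xiq x) (qp x).
exists xi; split=> //; apply/eqP; rewrite eq_le xip/=.
have xiN : xi (- y) = - xi y.
  by have := lxi (-1) y 0; rewrite addr0 scaleN1r (sublinear0 sxi) mulN1r addr0.
rewrite -lerN2 -xiN; exact: le_trans (xiq _) qy.
Qed.

End hahn_banach.

(** * Polynomials converging to a step *)
Section step_polynomials.
Context (R : realType).
Implicit Types (h w y z : R).

Lemma bernoulli_ineq y k : -1 <= y -> 1 + k%:R * y <= (1 + y) ^+ k.
Proof.
move=> y1; elim: k => [|k IH]; first by rewrite mul0r addr0 expr0.
rewrite exprS; apply: le_trans (ler_wpM2l _ IH); last by lra.
rewrite -natr1; have : 0 <= k%:R * (y * y) by rewrite mulr_ge0// -expr2 sqr_ge0.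
lra.
Qed.

Lemma ler_onem_mul_nat_expr w n : 0 <= w <= 1 -> (1 - w) * (n%:R * w ^+ n) <= 1 - w ^+ n.
Proof.
move=> /andP[w0 w1]; elim: n => [|n IH]; first by rewrite mul0r mulr0 expr0 subrr.
have : w ^+ n.+1 <= 1 by exact: exprn_ile1.
have : 0 <= w ^+ n by exact: exprn_ge0.
rewrite exprS -natr1; move: IH; set v := w ^+ n; set N := n%:R => IH v0 wv.
have : 0 <= (1 - w) * (1 - w * v) by rewrite mulr_ge0 ?subr_ge0.
have : w * ((1 - w) * (N * v)) <= w * (1 - v) by rewrite ler_wpM2l.
lra.
Qed.

(** With w the square root of z, n z ^ n = (n w ^ n) w ^ n, where the first
    factor is bounded by 1 / (1 - w). *)
Lemma cvg_nat_mul_expr z : 0 <= z < 1 -> n%:R * z ^+ n @[n --> \oo] --> (0 : R).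
Proof.
move=> /andP[z0 z1]; pose w := Num.sqrt z.
have w0 : 0 <= w := sqrtr_ge0 z.
have ww : w ^+ 2 = z by rewrite sqr_sqrtr.
have w1 : w < 1 by rewrite -[ltRHS](@sqrtr1 R) ltr_sqrt.
apply: (@squeeze_cvgr _ _ _ _ (cst 0) (geometric (1 - w)^-1 w)).
- near=> n; rewrite /= mulr_ge0 ?exprn_ge0//=.
  rewrite -ww -exprM mul2n -addnn exprD mulrA ler_wpM2r ?exprn_ge0//.
  rewrite -[leRHS]mulr1 ler_pdivlMl ?subr_gt0//.
  apply: le_trans (ler_onem_mul_nat_expr _ _) _; first by rewrite w0 ltW.
  by rewrite lerBlDr lerDl exprn_ge0.
- exact: cvg_cst.
- by apply: cvg_geometric; rewrite ger0_norm.
Unshelve. all: by end_near. Qed.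

(** The exponent n 2 ^ n, instead of the usual 2 ^ n, makes the limit at the
    threshold 1/2 equal to 0 instead of 1/e, so that the limit is exactly an
    indicator function. *)
Definition step_poly n h := (1 - h ^+ n) ^+ (n * 2 ^ n).

Lemma step_poly_itv n h : 0 <= h <= 1 -> 0 <= step_poly n h <= 1.
Proof.
move=> /andP[h0 h1]; have y0 : 0 <= h ^+ n by exact: exprn_ge0.
have y1 : h ^+ n <= 1 by exact: exprn_ile1.
by rewrite exprn_ge0 ?subr_ge0//= exprn_ile1 ?subr_ge0// lerBlDr lerDl.
Qed.

(** Bernoulli's inequality bounds (1 - y) ^ k below by 1 - k y, and above
    by 1 / (1 + k y); here k y = n (2 h) ^ n tends to 0 or to infinity
    according to the side of 1/2 on which h lies. *)
Lemma cvg_step_poly h : 0 <= h <= 1 ->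
  step_poly n h @[n --> \oo] --> ((h < 2^-1)%R%:R : R).
Proof.
move=> h01; have /andP[h0 h1] := h01.
have y0 n : 0 <= h ^+ n by exact: exprn_ge0.
have y1 n : h ^+ n <= 1 by exact: exprn_ile1.
have kE n : (n * 2 ^ n)%:R * h ^+ n = n%:R * (2 * h) ^+ n.
  by rewrite natrM natrX -mulrA -exprMn.
have [hlt|hge] := ltP h 2^-1 => /=.
- apply: (@squeeze_cvgr _ _ _ _ (fun n => 1 - n%:R * (2 * h) ^+ n) (cst 1)).
  + near=> n; have /andP[_ ->] := step_poly_itv n h01; rewrite andbT -kE.
    rewrite -mulrN; apply: bernoulli_ineq; have := y1 n; lra.
  + rewrite -[X in _ --> X]subr0; apply: cvgB; first exact: cvg_cst.
    by apply: cvg_nat_mul_expr; lra.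
  + exact: cvg_cst.
- apply: (@squeeze_cvgr _ _ _ _ (cst 0) harmonic).
  + near=> n; have /andP[-> _] := step_poly_itv n h01; rewrite /harmonic/=.
    rewrite -[leRHS]mul1r ler_pdivlMr ?ltr0n//.
    apply: (@le_trans _ _ (step_poly n h * (1 + h ^+ n) ^+ (n * 2 ^ n))).
      rewrite ler_wpM2l//; first by have /andP[] := step_poly_itv n h01.
      apply: le_trans (bernoulli_ineq _ _); last by have := y0 n; lra.
      rewrite kE -natr1 addrC lerD2l ler_peMr//.
      have h2 : 1 <= 2 * h by lra.
      exact: exprn_ege1.
    rewrite -exprMn exprn_ile1//.
      by rewrite mulr_ge0// ?subr_ge0// addr_ge0.
    by have := sqr_ge0 (h ^+ n); lra.
  + exact: cvg_cst.
  + exact: cvg_harmonic.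
Unshelve. all: by end_near. Qed.

End step_polynomials.

(** * Measures determined by an algebra of functions *)
Section function_algebra.
Context d (T : measurableType d) (R : realType).
Implicit Types (B : set (T -> R)) (f g : T -> R) (P Q : probability T R).

Inductive lin_span B : set (T -> R) :=
| span_base f : B f -> lin_span B f
| spanD f g : lin_span B f -> lin_span B g -> lin_span B (fun x => f x + g x)
| spanZ a f : lin_span B f -> lin_span B (fun x => a * f x).

Definition span_mul_closed B :=
  forall f g, B f -> B g -> lin_span B (fun x => f x * g x).

Lemma spanM B f g : span_mul_closed B ->
  lin_span B f -> lin_span B g -> lin_span B (fun x => f x * g x).
Proof.
move=> BM Bf; elim: Bf g => {f}[f Bf|f1 f2 _ IH1 _ IH2|a f _ IH] g Bg.
- elim: Bg => {g}[g Bg|g1 g2 _ IH1 _ IH2|a g _ IH]; first exact: BM.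
  + by under eq_fun do rewrite mulrDr; exact: spanD.
  + by under eq_fun do rewrite mulrCA; exact: spanZ.
- by under eq_fun do rewrite mulrDl; apply: spanD; [exact: IH1|exact: IH2].
- by under eq_fun do rewrite -mulrA; apply: spanZ; exact: IH.
Qed.

Lemma span_cst B a : B (cst 1) -> lin_span B (cst a).
Proof.
move=> B1; have -> : cst a = (fun x : T => a * cst 1 x).
  by apply/funext => x; rewrite mulr1.
by apply: spanZ; exact: span_base.
Qed.

Lemma spanX B f n : B (cst 1) -> span_mul_closed B ->
  lin_span B f -> lin_span B (fun x => f x ^+ n).
Proof.
move=> B1 BM Bf; elim: n => [|n IH].
  by under eq_fun do rewrite expr0; exact: span_base.
by under eq_fun do rewrite exprS; exact: spanM.
Qed.

Lemma span_step_poly B f n : B (cst 1) -> span_mul_closed B ->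
  lin_span B f -> lin_span B (fun x => step_poly n (f x)).
Proof.
move=> B1 BM Bf; apply: spanX => //.
have -> : (fun x => 1 - f x ^+ n) = (fun x => cst 1 x + (-1) * f x ^+ n).
  by apply/funext => x; rewrite mulN1r.
by apply: spanD; [exact: span_base|apply: spanZ; exact: spanX].
Qed.

Definition bounded_mfun f := measurable_fun setT f /\ exists M, forall x, `|f x| <= M.

Lemma bounded_mfun_span B f : B `<=` bounded_mfun -> lin_span B f -> bounded_mfun f.
Proof.
move=> Bb; elim=> {f}[f /Bb//|f g _ [mf [M fM]] _ [mg [N gN]]|a f _ [mf [M fM]]].
- split; first exact: measurable_funD.
  by exists (M + N) => x; apply: le_trans (ler_normD _ _) (lerD _ _).
- split; first exact: measurable_funM.
  by exists (`|a| * M) => x; rewrite normrM ler_wpM2l.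
Qed.

Lemma bounded_mfun_integrable P f : bounded_mfun f -> P.-integrable setT (EFin \o f).
Proof.
move=> [mf [M fM]]; apply: measurable_bounded_integrable => //.
  by apply: le_lt_trans (probability_le1 _ _) _ => //; rewrite ltry.
exists M; split; first exact: num_real.
by move=> N MN x _; exact: le_trans (fM x) (ltW MN).
Qed.

Lemma Rintegral_span P Q B : B `<=` bounded_mfun ->
  (forall f, B f -> \int[P]_x f x = \int[Q]_x f x) ->
  forall f, lin_span B f -> \int[P]_x f x = \int[Q]_x f x.
Proof.
move=> Bb PQ f; elim=> {f}[f /PQ//|f g Bf IHf Bg IHg|a f Bf IHf].
- have iB h Q' : lin_span B h -> Q'.-integrable setT (EFin \o h).
    by move=> /(bounded_mfun_span Bb)/bounded_mfun_integrable; exact.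
  rewrite !RintegralD//; [by rewrite IHf IHg|exact: iB..].
- have iB h Q' : lin_span B h -> Q'.-integrable setT (EFin \o h).
    by move=> /(bounded_mfun_span Bb)/bounded_mfun_integrable; exact.
  by rewrite !RintegralZl// ?IHf//; exact: iB.
Qed.

Lemma cvg_Rintegral_indic P (g : nat -> T -> R) (U : set T) : measurable U ->
  (forall n, measurable_fun setT (g n)) -> (forall n x, 0 <= g n x <= 1) ->
  (forall x, g ^~ x @ \oo --> (\1_U x : R)) ->
  \int[P]_x g n x @[n --> \oo] --> fine (P U).
Proof.
move=> mU mg g01 gU.
have mI : measurable_fun setT (\1_U : T -> R) by exact: measurable_indic.
have gU' : {ae P, forall x, setT x -> (g n x)%:E @[n --> \oo] --> (\1_U x : R)%:E}.
  by apply: aeW => x _; apply: cvg_EFin; [exact: nearW|exact: gU].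
have i1 : P.-integrable setT (cst 1%E).
  apply: (@bounded_mfun_integrable P (cst 1)).
  by split; [exact: measurable_cst|exists 1 => x; rewrite normr1].
have g1 : {ae P, forall x n, setT x -> (`|(g n x)%:E| <= cst 1 x)%E}.
  apply: aeW => x n _; have /andP[g0 g1] := g01 n x.
  by rewrite gee0_abs lee_fin.
have [_ _] := dominated_convergence measurableT
  (fun n => (measurable_EFinP _ _).2 (mg n)) ((measurable_EFinP _ _).2 mI) gU' i1 g1.
rewrite integral_indic// setIT => h; apply: fine_cvg.
by rewrite fineK ?fin_num_measure.
Qed.

(** The sets f < c are also of this form when the constants are in the span, so
    these sets generate the coarsest sigma-algebra making B measurable. *)
Definition negativity_sets B : set (set T) :=
  [set [set x | f x < 0] | f in lin_span B].

Lemma measurable_lin_span B f : B (cst 1) -> lin_span B f ->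
  measurable_fun [set: g_sigma_algebraType (negativity_sets B)]
    (f : g_sigma_algebraType (negativity_sets B) -> R).
Proof.
move=> B1 Bf; apply: (measurability _ (RGenInftyO.measurableE R)).
move=> _ [_ [c ->] <-]; rewrite setTI; apply: sub_sigma_algebra.
exists (fun x => f x + cst (- c) x); first by apply: spanD => //; exact: span_cst.
by apply/seteqP; split => x /=; rewrite in_itv/= subr_lt0.
Qed.

(** A functional monotone class theorem. A step polynomial of an affine
    function of f stays in the span and converges boundedly to the indicator of
    f < 0. The sets whose indicator is such a limit form a pi-system, because the
    span is closed under products, and P and Q agree on them by dominated
    convergence. *)
Theorem eq_measure_lin_span P Q B : B `<=` bounded_mfun -> B (cst 1) ->
  span_mul_closed B -> (forall f, B f -> \int[P]_x f x = \int[Q]_x f x) ->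
  forall U, <<s negativity_sets B >> U -> P U = Q U.
Proof.
move=> Bb B1 BM PQ.
pose G : set (set T) := [set U | measurable U /\ exists g : nat -> T -> R,
  [/\ forall n, lin_span B (g n), forall n x, 0 <= g n x <= 1 &
      forall x, g ^~ x @ \oo --> (\1_U x : R)]].
have Gm : G `<=` measurable by move=> U [].
have GT : G setT.
  split; first exact: measurableT.
  exists (fun _ => cst 1); split=> [n|n x|x]; first exact: span_base.
    by rewrite ler01 lexx.
  by rewrite indicT; exact: cvg_cst.
have GI : setI_closed G.
  move=> U V [mU [g [Bg g01 gU]]] [mV [h [Bh h01 hV]]]; split; first exact: measurableI.
  exists (fun n x => g n x * h n x); split=> [n|n x|x]; first exact: spanM.
    have /andP[g0 g1] := g01 n x; have /andP[h0 h1] := h01 n x.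
    by rewrite mulr_ge0//= mulr_ile1.
  by rewrite indicI; exact: cvgM (gU x) (hV x).
have GPQ U : G U -> P U = Q U.
  move=> [mU [g [Bg g01 gU]]].
  have mg n : measurable_fun setT (g n) := (bounded_mfun_span Bb (Bg n)).1.
  have cP := cvg_Rintegral_indic (P := P) mU mg g01 gU.
  have cQ := cvg_Rintegral_indic (P := Q) mU mg g01 gU.
  rewrite -[LHS]fineK ?fin_num_measure// -[RHS]fineK ?fin_num_measure//.
  have PQg : (fun n => \int[P]_x g n x) = (fun n => \int[Q]_x g n x).
    by apply/funext => n; exact: (Rintegral_span Bb PQ).
  by rewrite PQg in cP; congr (_%:E); exact: cvg_unique cP cQ.
move=> U sU; apply: (g_sigma_algebra_measure_unique G Gm (fun=> setT)) => //.
- by apply/seteqP; split=> // x _; exists 0%N.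
- by move=> _; apply: le_lt_trans (probability_le1 _ _) _ => //; rewrite ltry.
suff GB : negativity_sets B `<=` <<s G >>.
  apply: (smallest_sub (smallest_sigma_algebra setT G) GB). exact: sU.
move=> _ [f Bf <-]; apply: sub_sigma_algebra.
have [mf [M fM]] := bounded_mfun_span Bb Bf.
split.
  have := mf measurableT `]-oo, 0[%classic (measurable_itv _); rewrite setTI.
  by congr (measurable _); apply/seteqP; split => x /=; rewrite in_itv.
pose N := `|M| + 1; have N0 : 0 < N by rewrite ltr_wpDl.
have fN x : `|f x| <= N.
  by apply: le_trans (fM x) _; rewrite (le_trans (ler_norm M))// lerDl.
(* The affine map takes [-N, N] to [0, 1] and 0 to the threshold 1/2. *)
pose h x := 2^-1 * cst 1 x + (2 * N)^-1 * f x.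
have hB : lin_span B h by apply: spanD; apply: spanZ => //; exact: span_base.
have h01 x : 0 <= h x <= 1.
  have := fN x; rewrite ler_norml => /andP[f1 f2].
  have -> : h x = (N + f x) / (2 * N) by rewrite /h/=; field; rewrite gt_eqF.
  rewrite divr_ge0/= ?mulr_ge0//; [|lra|exact: ltW].
  by rewrite ler_pdivrMr ?mulr_gt0//; lra.
exists (fun n x => step_poly n (h x)); split=> [n|n x|x].
- exact: span_step_poly.
- exact: step_poly_itv.
- have := cvg_step_poly (h01 x); rewrite indicE mem_setE.
  have -> : (h x < 2^-1) = (f x < 0).
    by rewrite /h mulr1 -ltrBrDl subrr pmulr_rlt0// invr_gt0 mulr_gt0.
  exact.
Qed.

End function_algebra.

(** * The Borel sets of a separable normed space *)
Section dense_sequence.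
Context (R : realType) (E : completeNormedModType R).
Implicit Types (e : nat -> E) (U : set E).

(** Indexing the dense set by the naturals turns the countable unions over
    it into unions over nat. *)
Definition dense_seq e := forall (x : E) (r : R), 0 < r -> exists n, `|x - e n| < r.

Lemma separable_dense_seq : separable E -> exists e, dense_seq e.
Proof.
move=> [D /countable_injP[f] fI dD].
have /choice[e eP] n : exists x : E, forall d, D d -> f d = n -> d = x.
  have [[d [Dd fd]]|nd] := pselect (exists d, D d /\ f d = n).
    exists d => d' Dd' fd'; apply: fI; rewrite ?inE//.
    by rewrite fd fd'.
  by exists 0 => d Dd fd; exfalso; apply: nd; exists d.
exists e => x r r0.
have [d [xd Dd]] := dD (ball x r) (ex_intro _ x (ballxx x r0)) (ball_open _ _).
exists (f d); rewrite -(eP (f d) d)//.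
by move: xd; rewrite -ball_normE.
Qed.

Definition cball (x : E) (k : nat) : set E := [set y | `|y - x| <= k.+1%:R^-1].

Lemma open_cball_approx e U x : dense_seq e -> open U -> U x ->
  exists k, forall y, `|y - x| <= 2 * k.+1%:R^-1 -> U y.
Proof.
move=> de oU Ux; have [_/posnumP[r] rU] : nbhs_ball x U.
  by apply/nbhs_ballP; exact: open_nbhs_nbhs.
have [k _ /(_ k (leqnn k)) hk] := near_infty_natSinv_lt (r%:num / 2)%:pos.
exists k => y yx; apply: rU; rewrite -ball_normE/= distrC.
by apply: le_lt_trans yx _; rewrite mulrC -ltr_pdivlMr.
Qed.

Lemma open_bigcup_cball e U : dense_seq e -> open U ->
  U = \bigcup_n \bigcup_(k in [set k | cball (e n) k `<=` U]) cball (e n) k.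
Proof.
move=> de oU; apply/seteqP; split=> [x Ux|x [n _ [k kU]]]; last exact: kU.
have [k kU] := open_cball_approx de oU Ux.
have [n xn] := de x k.+1%:R^-1 (eqbRL (invr_gt0 _) (ltr0Sn _ _)).
exists n => //; exists k; last exact: ltW.
move=> y yn; apply: kU; apply: le_trans (ler_distD (e n) _ _) _.
by rewrite mulr_natl mulr2n lerD// distrC ltW.
Qed.

Lemma borel_sub_sigma_algebra e (G : set (set E)) : dense_seq e ->
  (forall n k, <<s G >> (cball (e n) k)) ->
  forall A : set (borel E), measurable A -> <<s G >> A.
Proof.
move=> de Gb; apply: smallest_sub; first exact: smallest_sigma_algebra.
move=> U oU; rewrite (open_bigcup_cball de oU).
have mG (A : set (g_sigma_algebraType G)) : <<s G >> A -> measurable A by [].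
apply: (@bigcupT_measurable _ (g_sigma_algebraType G)) => n.
by apply: (@bigcup_measurable _ (g_sigma_algebraType G)) => k _; exact: Gb.
Qed.

Lemma measurable_cball x k : measurable (cball x k : set (borel E)).
Proof.
rewrite -[X in measurable X]setCK; apply: measurableC.
apply: sub_sigma_algebra.
have -> : ~` cball x k = [set y | k.+1%:R^-1 < `|y - x|].
  by apply/seteqP; split => y /=; rewrite /cball/= ltNge => /negP.
apply: (@open_comp _ _ (fun y : E => `|y - x|) [set r | k.+1%:R^-1 < r]); last first.
  exact: open_gt.
by move=> y _; apply: cvg_norm; apply: cvgB; [exact: cvg_id|exact: cvg_cst].
Qed.

(** Separability is what makes the sum map measurable for the product of the two
    Borel sigma-algebras: the inverse image of an open set is a countable union
    of products of balls. *)
Lemma measurable_add : separable E ->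
  measurable_fun setT ((fun z => z.1 + z.2) : borel E * borel E -> borel E).
Proof.
move=> /separable_dense_seq[e de].
apply: (@measurability _ _ _ (borel E) _ _ (@open E)) => //.
move=> _ [U oU <-]; rewrite setTI.
suff -> : (fun z : borel E * borel E => (z.1 : E) + z.2) @^-1` U =
    \bigcup_n \bigcup_m \bigcup_(k in [set k | forall y z, cball (e n) k y ->
      cball (e m) k z -> U (y + z)]) (cball (e n) k `*` cball (e m) k).
  apply: bigcupT_measurable => n; apply: bigcupT_measurable => m.
  apply: bigcup_measurable => k _.
  by apply: measurableX; exact: measurable_cball.
apply/seteqP; split=> [[x y] /= Uxy|[x y] [n _ [m _ [k kU [/= xn ym]]]]]; last exact: kU.
have [k kU] := open_cball_approx de oU Uxy.
(* 1 / (k' + 1) is half of 1 / (k + 1): each summand uses two such radii. *)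
pose k' := (k.*2.+1)%N.
have k'E : (k'.+1%:R : R) = 2 * k.+1%:R.
  by rewrite /k' -doubleS -mul2n natrM.
have k'0 : 0 < k'.+1%:R^-1 :> R by rewrite invr_gt0.
have [n xn] := de x _ k'0; have [m ym] := de y _ k'0.
exists n => //; exists m => //; exists k'; last by split; exact: ltW.
move=> y' z' yn zm; apply: kU.
have -> : y' + z' - (x + y) = ((y' - e n) + (e n - x)) + ((z' - e m) + (e m - y)).
  by rewrite !subrKA opprD addrACA.
apply: le_trans (ler_normD _ _) _.
have -> : 2 * k.+1%:R^-1 = (k'.+1%:R^-1 + k'.+1%:R^-1) + (k'.+1%:R^-1 + k'.+1%:R^-1) :> R.
  have : k.+1%:R != 0 :> R by rewrite pnatr_eq0.
  by rewrite k'E; set K := k.+1%:R => K0; field.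
apply: lerD; apply: le_trans (ler_normD _ _) _; apply: lerD => //;
  by rewrite distrC ltW.
Qed.

End dense_sequence.

(** * Characteristic functionals determine measures *)
Section functionals.
Context (R : realType) (E : completeNormedModType R).
Implicit Types (xi eta : E -> R) (x : E).

Definition cont_functional xi := scalar xi /\ continuous xi.

Lemma functionalZ xi a x : cont_functional xi -> xi (a *: x) = a * xi x.
Proof.
move=> [l _]; have x0 : xi 0 = 0.
  by have := l (-1) 0 0; rewrite scaler0 addr0 mulN1r addNr.
by rewrite -[a *: x]addr0 l x0 addr0.
Qed.

Lemma functionalD xi x y : cont_functional xi -> xi (x + y) = xi x + xi y.
Proof. by move=> [l _]; rewrite -[x in LHS]scale1r l mul1r. Qed.

Lemma cont_functional_lin a b xi eta : cont_functional xi -> cont_functional eta ->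
  cont_functional (fun x => a * xi x + b * eta x).
Proof.
move=> [lx cx] [le ce]; split; first by move=> c x y /=; rewrite lx le; ring.
by move=> x; apply: cvgD; apply: cvgM; try exact: cvg_cst; [exact: cx|exact: ce].
Qed.

Lemma measurable_functional xi : cont_functional xi ->
  measurable_fun [set: borel E] (xi : borel E -> R).
Proof.
move=> [_ cx]; apply: (measurability _ (RGenInftyO.measurableE R)).
move=> _ [_ [c ->] <-]; rewrite setTI; apply: sub_sigma_algebra.
by apply: open_comp => [x _|]; [exact: cx|exact: interval_open].
Qed.

(** Such functionals at the points of a dense sequence recover the norm as a
    countable supremum. *)
Lemma norming_functional x : exists xi, [/\ cont_functional xi,
  forall y, xi y <= `|y| & xi x = `|x|].
Proof.
have sn : sublinear (fun y : E => `|y|).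
  by split=> [y z|a y a0]; [exact: ler_normD|rewrite normrZ ger0_norm].
have [xi [lx xn xx]] := hahn_banach_dominated x sn; exists xi; split=> //.
split=> // y; apply/cvgrPdist_lt => r r0.
have xiB u v : xi u - xi v <= `|u - v|.
  have -> : xi u - xi v = xi (-1 *: v + u) by rewrite lx mulN1r addrC.
  by rewrite scaleN1r addrC.
near=> z; apply: le_lt_trans (_ : `|y - z| < r); last first.
  suff : ball y r z by rewrite -ball_normE.
  by near: z; exact: nbhsx_ballx.
by rewrite ler_norml xiB andbT lerNl opprB distrC xiB.
Unshelve. all: by end_near. Qed.

Definition trig_functions : set (E -> R) := [set f | exists xi, cont_functional xi /\
  (f = (fun x => cos (xi x)) \/ f = (fun x => sin (xi x)))].

Lemma cos_trig_function xi : cont_functional xi -> trig_functions (fun x => cos (xi x)).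
Proof. by move=> cxi; exists xi; split=> //; left. Qed.

Lemma sin_trig_function xi : cont_functional xi -> trig_functions (fun x => sin (xi x)).
Proof. by move=> cxi; exists xi; split=> //; right. Qed.

Lemma cst1_trig_function : trig_functions (cst 1).
Proof.
exists (cst 0); split; last by left; apply/funext => x; rewrite cos0.
by split; [move=> a x y; rewrite mulr0 addr0|exact: cst_continuous].
Qed.

(** Product-to-sum formulas; the sum and the difference of two functionals are
    functionals. *)
Lemma trig_functions_mul_closed :
  span_mul_closed (T := borel E) (trig_functions : set (borel E -> R)).
Proof.
move=> f g [xi [cxi xiE]] [eta [ceta etaE]].
have cD : cont_functional (fun x => 1 * xi x + 1 * eta x) by exact: cont_functional_lin.
have cB : cont_functional (fun x => 1 * xi x + (-1) * eta x) by exact: cont_functional_lin.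
have S F G a b : trig_functions F -> trig_functions G ->
    lin_span (T := borel E) (trig_functions : set (borel E -> R))
      (fun x : borel E => a * F x + b * G x).
  by move=> tf tg; apply: spanD; apply: spanZ; exact: span_base.
case: xiE => ->; case: etaE => -> {f g}.
- have := S _ _ 2^-1 2^-1 (cos_trig_function cB) (cos_trig_function cD).
  by congr (lin_span _ _); apply/funext => x; rewrite !mul1r mulN1r cosB cosD; field.
- have := S _ _ 2^-1 (- 2^-1) (sin_trig_function cD) (sin_trig_function cB).
  by congr (lin_span _ _); apply/funext => x; rewrite !mul1r mulN1r sinB sinD; field.
- have := S _ _ 2^-1 2^-1 (sin_trig_function cD) (sin_trig_function cB).
  by congr (lin_span _ _); apply/funext => x; rewrite !mul1r mulN1r sinB sinD; field.
- have := S _ _ 2^-1 (- 2^-1) (cos_trig_function cB) (cos_trig_function cD).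
  by congr (lin_span _ _); apply/funext => x; rewrite !mul1r mulN1r cosB cosD; field.
Qed.

Lemma trig_functions_bounded :
  (trig_functions : set (borel E -> R)) `<=` bounded_mfun (T := borel E) (R := R).
Proof.
move=> f [xi [cxi [->|->]]]; split.
- by apply: (measurableT_comp (continuous_measurable_fun (@continuous_cos R)));
    exact: measurable_functional.
- by exists 1 => x; exact: cos_max.
- by apply: (measurableT_comp (continuous_measurable_fun (@continuous_sin R)));
    exact: measurable_functional.
- by exists 1 => x; exact: sin_max.
Qed.

(** This is the derivative of sin at 0. It makes each functional measurable for
    the sigma-algebra of the trigonometric functions. *)
Lemma cvg_nat_mul_sin_div (a : R) : n.+1%:R * sin (a / n.+1%:R) @[n --> \oo] --> a.
Proof.
have [->|a0] := eqVneq a 0.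
  by under eq_fun do rewrite mul0r sin0 mulr0; exact: cvg_cst.
have dsin : h^-1 *: ((sin \o shift 0) (h *: 1) - sin 0) @[h --> 0^'] --> (1 : R).
  rewrite -[X in _ --> X](@cos0 R) -[X in _ --> X](derive_val (is_derive := is_derive_sin 0)).
  exact: (@derivable_sin R 0).
have {dsin} dsin := (cvgr_dnbhsP _ _ _).1 dsin (fun n => a / n.+1%:R).
have /dsin/(cvgM (cvg_cst a)) : (forall n, a / n.+1%:R != 0) /\
    a / n.+1%:R @[n --> \oo] --> (0 : R).
  split=> [n|]; first by rewrite mulf_neq0// invr_eq0 pnatr_eq0.
  by rewrite -[X in _ --> X](mulr0 a); apply: cvgM; [exact: cvg_cst|exact: cvg_harmonic].
rewrite mulr1; apply: cvg_trans; apply: near_eq_cvg; near=> n.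
rewrite /= addr0 sin0 subr0 [_ *: 1]mulr1 -[_ *: sin _]/((a / n.+1%:R)^-1 * sin _).
by rewrite mulrA invfM invrK mulrA divff// mul1r.
Unshelve. all: by end_near. Qed.

(** The algebra of trigonometric functions of functionals generates the Borel
    sets: every functional is a limit of members of the algebra, and a closed
    ball is a countable intersection of half-spaces given by norming
    functionals. *)
Theorem eq_measure_char_functional (P Q : probability (borel E) R) : separable E ->
  (forall xi, cont_functional xi -> \int[P]_x cos (xi x) = \int[Q]_x cos (xi x) /\
                                   \int[P]_x sin (xi x) = \int[Q]_x sin (xi x)) ->
  P ≡ Q.
Proof.
move=> /separable_dense_seq[e de] PQ A mA.
pose B : set (borel E -> R) := trig_functions.
have B1 : B (cst 1) := cst1_trig_function.
apply: (eq_measure_lin_span (B := B)) => //.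
- exact: trig_functions_bounded.
- exact: trig_functions_mul_closed.
- by move=> f [xi [/PQ[cE sE] [->|->]]].
pose G := negativity_sets B.
apply: (borel_sub_sigma_algebra de) mA => n k.
have /choice[xi_ xiP] m := norming_functional (e m).
have mxi xi : cont_functional xi ->
    measurable_fun [set: g_sigma_algebraType G] (xi : g_sigma_algebraType G -> R).
  move=> cxi.
  apply: (@measurable_fun_cvg _ (g_sigma_algebraType G) R setT
    (fun (m : nat) (x : E) => m.+1%:R * sin (xi x / m.+1%:R))) => [m|x _].
    apply: measurable_lin_span => //; apply: spanZ; apply: span_base.
    apply: sin_trig_function.
    have := cont_functional_lin m.+1%:R^-1 0 cxi cxi.
    by congr cont_functional; apply/funext => x; rewrite mul0r addr0 mulrC.
  exact: cvg_nat_mul_sin_div.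
have -> : cball (e n) k =
    \bigcap_m [set x | xi_ m x <= k.+1%:R^-1 + xi_ m (e n)].
  apply/seteqP; split => [x xk m _ /=|x xk].
    have [cxi xin _] := xiP m; rewrite -lerBlDr; apply: le_trans xk.
    by rewrite -mulN1r -functionalZ// -functionalD// scaleN1r xin.
  apply/ler_addgt0Pr => r r0.
  have r20 : 0 < r / 2 by rewrite divr_gt0.
  have [m xm] := de (x - e n) (r / 2) r20.
  have [cxi xin xie] := xiP m; have := xk m I; rewrite /= => xkm.
  have h1 : xi_ m (e m) - xi_ m (x - e n) <= `|e m - (x - e n)|.
    by rewrite -[- xi_ m _]mulN1r -functionalZ// -functionalD// scaleN1r xin.
  have h2 : xi_ m (x - e n) = xi_ m x - xi_ m (e n).
    by rewrite functionalD// -scaleN1r functionalZ// mulN1r.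
  have h3 : `|x - e n| <= `|x - e n - e m| + `|e m|.
    by rewrite -[in leLHS](subrK (e m) (x - e n)) ler_normD.
  rewrite distrC in h1; rewrite xie h2 in h1.
  move: h1 h3 xkm xm; set u := `|x - e n|; set v := `|x - e n - e m|.
  move: u v k.+1%:R^-1 (xi_ m x) (xi_ m (e n)) `|e m| => u v c a b w; lra.
apply: (@bigcapT_measurable _ (g_sigma_algebraType G)) => m.
have [cxi _ _] := xiP m.
have := mxi _ cxi measurableT `]-oo, k.+1%:R^-1 + xi_ m (e n)]%classic (measurable_itv _).
by rewrite setTI; congr (measurable _); apply/seteqP; split => x /=; rewrite in_itv.
Qed.

End functionals.

(** * Integrals over images and products *)
Section probability_integrals.
Context d1 d2 d3 (T1 : measurableType d1) (T2 : measurableType d2)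
  (T3 : measurableType d3) (R : realType).
Variables (P1 : probability T1 R) (P2 : probability T2 R).

Lemma bounded_mfun_comp d d' (T : measurableType d) (T' : measurableType d')
    (f : T' -> R) (phi : T -> T') : bounded_mfun f -> measurable_fun setT phi ->
  bounded_mfun (f \o phi).
Proof.
by move=> [mf [M fM]] mphi; split; [exact: measurableT_comp|exists M => x; exact: fM].
Qed.

Lemma Rintegral_law d d' (T : measurableType d) (T' : measurableType d')
    (P : probability T R) (phi : T -> T') (mphi : measurable_fun setT phi)
    (f : T' -> R) : bounded_mfun f ->
  \int[law P mphi]_y f y = \int[P]_x f (phi x).
Proof.
move=> bf; rewrite /Rintegral; congr fine.
rewrite [LHS](@integral_pushforward _ _ T T' R phi mphi P setT (EFin \o f))//.
- exact/measurable_EFinP/bf.1.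
- by have := bounded_mfun_integrable P (bounded_mfun_comp bf mphi).
Qed.

Lemma eq_measure_Rintegral d (T : measurableType d) (P Q : probability T R) f :
  P ≡ Q -> \int[P]_x f x = \int[Q]_x f x.
Proof. by move=> PQ; congr fine; apply: eq_measure_integral => A mA _; exact: PQ. Qed.

Lemma Rintegral_prod (f : T1 * T2 -> R) : bounded_mfun f ->
  \int[(P1 \x P2)%E]_z f z = \int[P1]_x \int[P2]_y f (x, y).
Proof.
move=> bf; rewrite /Rintegral; congr fine.
have If : (P1 \x P2)%E.-integrable setT (EFin \o f) by exact: bounded_mfun_integrable.
rewrite -(integral12_prod_meas1 If); apply: eq_integral => x _.
rewrite fineK//; apply: integrable_fin_num => //.
by apply: (@bounded_mfun_integrable _ _ _ P2 (fun y => f (x, y)));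
  apply: (bounded_mfun_comp bf); exact: measurable_pair1.
Qed.

Lemma Rintegral_swap (f : T1 * T2 -> R) : bounded_mfun f ->
  \int[P1]_x \int[P2]_y f (x, y) = \int[P2]_y \int[P1]_x f (x, y).
Proof.
move=> bf; rewrite -Rintegral_prod// /Rintegral; congr fine.
have If : (P1 \x P2)%E.-integrable setT (EFin \o f) by exact: bounded_mfun_integrable.
rewrite -(integral21_prod_meas1 If); apply: eq_integral => y _.
rewrite fineK//; apply: integrable_fin_num => //.
by apply: (@bounded_mfun_integrable _ _ _ P1 (fun x => f (x, y)));
  apply: (bounded_mfun_comp bf); exact: measurable_pair2.
Qed.

Lemma Rintegral_image_prod (phi : T1 * T2 -> T3) (P3 : probability T3 R) (f : T3 -> R) :
  measurable_fun setT phi -> pushforward (P1 \x P2)%E phi ≡ P3 -> bounded_mfun f ->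
  \int[P3]_z f z = \int[P1]_x \int[P2]_y f (phi (x, y)).
Proof.
move=> mphi PP bf.
rewrite -(Rintegral_prod (bounded_mfun_comp bf mphi)) -(Rintegral_law (P1 \x P2)%E mphi bf).
by apply: eq_measure_Rintegral => A mA; rewrite -PP.
Qed.

Lemma Rintegral_cst_probability d (T : measurableType d) (P : probability T R) (r : R) :
  \int[P]_x r = r.
Proof.
have PT : P setT = 1%E := probability_setT P.
by rewrite Rintegral_cst// [X in fine X]PT mulr1.
Qed.

Lemma normr_Rintegral_le1 d (T : measurableType d) (P : probability T R) (f : T -> R) :
  measurable_fun setT f -> (forall x, `|f x| <= 1) -> `|\int[P]_x f x| <= 1.
Proof.
move=> mf f1; have bf : bounded_mfun f by split=> //; exists 1.
apply: le_trans (le_normr_Rintegral _ _) _ => //; first exact: bounded_mfun_integrable.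
rewrite -[leRHS](Rintegral_cst_probability P).
apply: le_Rintegral => //; apply: bounded_mfun_integrable.
- by split; [exact: measurableT_comp|exists 1 => x; rewrite normr_id].
- by split; [exact: measurable_cst|exists 1 => x; rewrite normr1].
Qed.

Lemma Rintegral_lin_comb d (T : measurableType d) (P : probability T R) (a b : R)
    (f h : T -> R) : bounded_mfun f -> bounded_mfun h ->
  \int[P]_x (a * f x + b * h x) = a * \int[P]_x f x + b * \int[P]_x h x.
Proof.
move=> bf bh.
have Z c k : bounded_mfun k -> P.-integrable setT (EFin \o (fun x => c * k x)).
  move=> bk; apply: bounded_mfun_integrable.
  apply: (@bounded_mfun_span _ T R [set k]); first by move=> _ ->.
  by apply: spanZ; exact: span_base.
rewrite RintegralD//; [|exact: Z..].
by rewrite !RintegralZl//; exact: bounded_mfun_integrable.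
Qed.

End probability_integrals.

(** * One-dimensional transforms of scale mixtures *)
Section transform.
Context (R : realType) (E : completeNormedModType R) (xi : E -> R).
Hypothesis cxi : cont_functional xi.
Implicit Types (g : R -> R) (m : probability (borel E) R) (lam : probability R R) (t : R).

(** The properties of cos and sin that the integrals below need. They pass to
    the transforms themselves, so that iterated transforms are covered. *)
Definition continuous_le1 g := continuous g /\ forall x, `|g x| <= 1.

Lemma continuous_le1_cos : continuous_le1 (@cos R).
Proof. by split; [exact: continuous_cos|exact: cos_max]. Qed.

Lemma continuous_le1_sin : continuous_le1 (@sin R).
Proof. by split; [exact: continuous_sin|exact: sin_max]. Qed.

Lemma bounded_mfun_continuous_le1 g : continuous_le1 g -> bounded_mfun g.
Proof. by move=> [cg g1]; split; [exact: continuous_measurable_fun|exists 1]. Qed.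

Lemma bounded_mfun_comp_functional g t : continuous_le1 g ->
  bounded_mfun (T := borel E) (fun x : borel E => g (t * xi x)).
Proof.
move=> /bounded_mfun_continuous_le1 bg; apply: (bounded_mfun_comp bg).
by apply: measurable_funM; [exact: measurable_cst|exact: measurable_functional].
Qed.

(** For g = cos and g = sin these are the real and imaginary parts of the
    characteristic function of the image of m under xi. *)
Definition transform g m t := \int[m]_x g (t * xi x).

Lemma continuous_le1_transform g m : continuous_le1 g ->
  continuous_le1 (transform g m).
Proof.
move=> cg; split=> [t|t]; last first.
  by apply: normr_Rintegral_le1 => [|x]; [exact: (bounded_mfun_comp_functional t cg).1|exact: cg.2].
have := @continuity_under_integral R _ (borel E) m (fun t x => g (t * xi x)) setT
  measurableT (t - 1) (t + 1) _ _ (cst 1) _ _ t.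
apply.
- by move=> u _; apply: bounded_mfun_integrable; exact: bounded_mfun_comp_functional.
- apply: aeW => x _ u _; apply: continuous_comp; last exact: cg.1.
  by apply: cvgM; [exact: cvg_id|exact: cvg_cst].
- apply: (@bounded_mfun_integrable _ _ _ m (cst 1)).
  by split; [exact: measurable_cst|exists 1 => x; rewrite normr1].
- by move=> u _; apply: aeW => x _; exact: cg.2.
- by rewrite inE /= in_itv/= ltrBlDr ltrDl ltr01.
Qed.

Lemma transform_mixture g mu lam t : continuous_le1 g ->
  transform g (scale_mixture mu lam) t = \int[lam]_s transform g mu (t * s).
Proof.
move=> cg; rewrite /transform.
rewrite (@Rintegral_image_prod _ _ _ R (borel E) (borel E) R lam mu
  (fun z => z.1 *: (z.2 : E)) (scale_mixture mu lam) (fun x => g (t * xi x))).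
- apply: eq_Rintegral => s _; apply: eq_Rintegral => x _ /=.
  by rewrite (functionalZ _ _ cxi) mulrA.
- exact: measurable_scale_pair.
- by move=> A mA; rewrite /= scale_mixture_law.
- exact: bounded_mfun_comp_functional.
Qed.

Lemma bounded_mfun_transform_mul g mu : continuous_le1 g ->
  bounded_mfun (fun z : R * R => transform g mu (z.1 * z.2)).
Proof.
move=> cg; have bg := bounded_mfun_continuous_le1 (continuous_le1_transform mu cg).
apply: (bounded_mfun_comp bg).
by apply: measurable_funM; [exact: measurable_fst|exact: measurable_snd].
Qed.

Lemma bounded_mfun_transform_scale g mu t : continuous_le1 g ->
  bounded_mfun (fun s : R => transform g mu (t * s)).
Proof.
move=> cg; have bg := bounded_mfun_continuous_le1 (continuous_le1_transform mu cg).
by apply: (bounded_mfun_comp bg); exact: mulrl_measurable.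
Qed.

(** Both sides are the double integral of transform g mu (s t) over
    lam and kap. Hence two mixing measures that give the same transforms agree
    on the transform of every mixture. *)
Lemma Rintegral_transform_swap g mu lam kap : continuous_le1 g ->
  \int[lam]_s transform g (scale_mixture mu kap) s =
  \int[kap]_t transform g (scale_mixture mu lam) t.
Proof.
move=> cg.
under eq_Rintegral do rewrite transform_mixture//.
rewrite (@Rintegral_swap _ _ _ _ R lam kap
  (fun z : R * R => transform g mu (z.1 * z.2))); last first.
  exact: bounded_mfun_transform_mul.
apply: eq_Rintegral => t _; rewrite transform_mixture//.
by apply: eq_Rintegral => s _; rewrite mulrC.
Qed.

Lemma transform_mixture_dirac g mu s t : continuous_le1 g ->
  transform g (scale_mixture mu (@dirac _ R s R)) t = transform g mu (t * s).
Proof.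
move=> cg; rewrite transform_mixture// /Rintegral integral_dirac//=.
  by rewrite indicT mul1r.
by apply/measurable_EFinP; exact: (bounded_mfun_transform_scale mu t cg).1.
Qed.

Lemma transform_mixture_law g mu lam (phi : R -> R) (mphi : measurable_fun setT phi) t :
  continuous_le1 g ->
  transform g (scale_mixture mu (law lam mphi)) t =
  \int[lam]_s transform g mu (t * phi s).
Proof.
by move=> cg; rewrite transform_mixture// Rintegral_law//; exact: bounded_mfun_transform_scale.
Qed.

Lemma transform_scaleR g mu a lam t : continuous_le1 g ->
  transform g (scale_mixture mu (scaleR a lam)) t =
  transform g (scale_mixture mu lam) (t * a).
Proof.
move=> cg; rewrite transform_mixture_law// transform_mixture//.
by apply: eq_Rintegral => s _; rewrite mulrA.
Qed.

Lemma transform_cosN m t : transform (@cos R) m (- t) = transform (@cos R) m t.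
Proof. by apply: eq_Rintegral => x _; rewrite mulNr cosN. Qed.

Lemma transform_sinN m t : transform (@sin R) m (- t) = - transform (@sin R) m t.
Proof.
have := RintegralZl (-1) measurableT
  (bounded_mfun_integrable m (bounded_mfun_comp_functional t continuous_le1_sin)).
rewrite mulN1r => <-; apply: eq_Rintegral => x _.
by rewrite mulNr sinN mulN1r.
Qed.

Lemma transform_cos0 m : transform (@cos R) m 0 = 1.
Proof.
rewrite /transform; under eq_Rintegral do rewrite mul0r cos0.
exact: Rintegral_cst_probability.
Qed.

Lemma transform_sin0 m : transform (@sin R) m 0 = 0.
Proof.
rewrite /transform; under eq_Rintegral do rewrite mul0r sin0.
exact: Rintegral_cst_probability.
Qed.

Lemma transform_factor g mu lam1 lam2 lam t : separable E -> continuous_le1 g ->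
  mixture_factor mu lam1 lam2 lam ->
  transform g (scale_mixture mu lam) t =
  \int[scale_mixture mu lam1]_x \int[scale_mixture mu lam2]_y g (t * xi x + t * xi y).
Proof.
move=> sepE cg lamE; rewrite {1}/transform.
rewrite (@Rintegral_image_prod _ _ _ (borel E) (borel E) (borel E) R
  (scale_mixture mu lam1) (scale_mixture mu lam2)
  (fun z => (z.1 : E) + z.2) (scale_mixture mu lam) (fun x => g (t * xi x))).
- apply: eq_Rintegral => x _; apply: eq_Rintegral => y _ /=.
  by rewrite (functionalD _ _ cxi) mulrDr.
- exact: measurable_add.
- exact: lamE.
- exact: bounded_mfun_comp_functional.
Qed.

(** Together with the next lemma, this is the multiplicativity of
    characteristic functions, in real and imaginary parts. *)
Lemma transform_cos_factor mu lam1 lam2 lam t : separable E ->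
  mixture_factor mu lam1 lam2 lam ->
  transform (@cos R) (scale_mixture mu lam) t =
  transform (@cos R) (scale_mixture mu lam1) t * transform (@cos R) (scale_mixture mu lam2) t -
  transform (@sin R) (scale_mixture mu lam1) t * transform (@sin R) (scale_mixture mu lam2) t.
Proof.
move=> sepE lamE; rewrite (transform_factor _ sepE continuous_le1_cos lamE).
have bc := bounded_mfun_comp_functional t continuous_le1_cos.
have bs := bounded_mfun_comp_functional t continuous_le1_sin.
have inner (x : borel E) : \int[scale_mixture mu lam2]_y cos (t * xi x + t * xi y) =
    transform (@cos R) (scale_mixture mu lam2) t * cos (t * xi x) +
    - transform (@sin R) (scale_mixture mu lam2) t * sin (t * xi x).
  under eq_Rintegral do rewrite cosD -mulNr.
  by rewrite Rintegral_lin_comb// /transform; ring.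
under eq_Rintegral do rewrite inner.
by rewrite Rintegral_lin_comb// /transform; ring.
Qed.

Lemma transform_sin_factor mu lam1 lam2 lam t : separable E ->
  mixture_factor mu lam1 lam2 lam ->
  transform (@sin R) (scale_mixture mu lam) t =
  transform (@sin R) (scale_mixture mu lam1) t * transform (@cos R) (scale_mixture mu lam2) t +
  transform (@cos R) (scale_mixture mu lam1) t * transform (@sin R) (scale_mixture mu lam2) t.
Proof.
move=> sepE lamE; rewrite (transform_factor _ sepE continuous_le1_sin lamE).
have bc := bounded_mfun_comp_functional t continuous_le1_cos.
have bs := bounded_mfun_comp_functional t continuous_le1_sin.
have inner (x : borel E) : \int[scale_mixture mu lam2]_y sin (t * xi x + t * xi y) =
    transform (@cos R) (scale_mixture mu lam2) t * sin (t * xi x) +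
    transform (@sin R) (scale_mixture mu lam2) t * cos (t * xi x).
  under eq_Rintegral do rewrite sinD.
  by rewrite Rintegral_lin_comb// /transform; ring.
under eq_Rintegral do rewrite inner.
by rewrite Rintegral_lin_comb// /transform; ring.
Qed.

End transform.

(** * Recovering an interval from separating continuous functions *)
Section interval_recovery.
Context (R : realType) (G : set (set R)) (h : nat -> R -> R) (a b : R).
Hypothesis ch : forall i, continuous (h i).
Hypothesis mh : forall i, measurable_fun [set: g_sigma_algebraType G] (h i).
Hypothesis sep : forall s q, ~ (`[a, b]%classic s) -> `[a, b]%classic q -> exists i, h i s != h i q.

(** Compactness: a point s lies in the interval as soon as, for each n, some
    point of a countable dense subset of it has its first n + 1 values within
    1 / (n + 1) of those of s. Indeed a cluster point of these approximations is
    in the interval and is not separated from s. The resulting description of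
    the interval uses countably many operations. *)
Lemma separated_itv_sigma : <<s G >> `[a, b]%classic.
Proof.
have [ab|ba] := leP a b; last first.
  rewrite set_itv_ge ?bnd_simp -?ltNge//.
  exact: (@measurable0 _ (g_sigma_algebraType G)).
(* Clamping the rationals gives the dense subset, also when a = b is irrational. *)
pose cl (q : R) := Num.max a (Num.min b q).
have clab q : `[a, b]%classic (cl q).
  by rewrite /= in_itv/= le_max lexx/= ge_max ab ge_min lexx.
have clE s q : `[a, b]%classic s -> `|s - cl q| <= `|s - q|.
  rewrite /= in_itv/= => /andP[sa sb]; rewrite /cl.
  have [bq|qb] := leP b q.
    have -> : Num.max a b = b by apply/max_idPr.
    by rewrite ler_norml; have := ler_norm (q - s); rewrite distrC; lra.
  have [qa|aq] := leP a q => //.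
  by rewrite ler_norml; have := ler_norm (s - q); lra.
have -> : `[a, b]%classic = \bigcap_n \bigcup_(q : rat)
    \bigcap_(i in [set i | (i <= n)%N]) [set s | `|h i s - h i (cl (ratr q))| < n.+1%:R^-1].
  apply/seteqP; split => [s sab n _|s Hs].
    have n0 : 0 < n.+1%:R^-1 :> R by rewrite invr_gt0.
    have : \forall q \near s, forall i : 'I_n.+1, `|h i s - h i q| < n.+1%:R^-1.
      apply: (@filter_forall R _ (fun (i : 'I_n.+1) q => `|h i s - h i q| < n.+1%:R^-1) _
        (nbhs_filter s)) => i.
      by have := @ch i s; move/cvgrPdist_lt => /(_ _ n0).
    move=> /nbhs_ballP[r /= r0 rh].
    have [w [sq [q _ qE]]] := @dense_rat R (ball s r) (ex_intro _ s (ballxx s r0))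
      (ball_open _ _).
    exists q => // i /= ilen.
    apply: (rh (cl (ratr q)) _ (Ordinal (ilen : (i < n.+1)%N))).
    move: sq; rewrite -qE -ball_normE /= => sq.
    exact: le_lt_trans (clE _ _ sab) sq.
  have /choice[q qP] n : exists q : rat, forall i, (i <= n)%N ->
      `|h i s - h i (cl (ratr q))| < n.+1%:R^-1.
    by have [q _ qP] := Hs n I; exists q => i ilen; exact: qP.
  apply: contrapT => sab.
  have [p [pab clp]] : `[a, b]%classic `&` cluster ((fun n => cl (ratr (q n))) @ \oo) !=set0.
    by apply: (@segment_compact R a b); exists 0%N => // n _; exact: clab.
  have [i hi] := @sep _ _ sab pab.
  have e0 : 0 < `|h i s - h i p| / 2 by rewrite divr_gt0// normr_gt0 subr_eq0.
  have [N _ hN] := near_infty_natSinv_lt (PosNum e0).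
  (* From index max N i on, the error is below e0 and the i-th function is controlled. *)
have [||w [[n /= nN nE] /= hp]] := clp [set cl (ratr (q n)) | n in [set n | (maxn N i <= n)%N]]
    [set x | `|h i p - h i x| < `|h i s - h i p| / 2].
  - by exists (maxn N i) => // n /= nN; exists n.
  - by have := @ch i p; move/cvgrPdist_lt => /(_ _ e0).
  rewrite -nE in hp; have := qP n i (leq_trans (leq_maxr _ _) nN).
  have := hN n (leq_trans (leq_maxl _ _) nN) => /= nlt.
  have := ler_normD (h i s - h i (cl (ratr (q n)))) (h i (cl (ratr (q n))) - h i p).
  rewrite subrKA [X in _ <= _ + X]distrC => le1 lt1.
  have := ltrD (lt_trans lt1 nlt) hp; rewrite -splitr => /(le_lt_trans le1).
  by rewrite ltxx.
pose T' := g_sigma_algebraType G.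
apply: (@bigcapT_measurable _ T') => n.
apply: (@countable_bigcupT_measurable _ T') => // q.
apply: (@bigcap_measurable _ T'); first by exists 0%N.
move=> i _.
have := @mh i measurableT _ (measurable_ball (h i (cl (ratr q))) n.+1%:R^-1).
rewrite setTI; congr (measurable _); apply/seteqP; split => x /=;
  by rewrite -ball_normE/= distrC.
Qed.

End interval_recovery.

(** * Cancelling the mixing measure *)
Lemma eq_measure_itvNyc (R : realType) (P Q : probability R R) :
  (forall b, P `]-oo, b]%classic = Q `]-oo, b]%classic) -> P ≡ Q.
Proof.
move=> PQ; pose G : set (set R) := [set `]-oo, b]%classic | b in setT].
have GI : setI_closed G.
  move=> _ _ [b _ <-] [c _ <-]; exists (Num.min b c) => //.
  by apply/seteqP; split => x /=; rewrite !in_itv/= le_min => /andP.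
have mid : measurable_fun [set: g_sigma_algebraType G] (id : g_sigma_algebraType G -> R).
  apply: (measurability _ (RGenOInfty.measurableE R)).
  move=> _ [_ [b ->] <-]; rewrite setTI preimage_id -setCitvl.
  apply: (@measurableC _ (g_sigma_algebraType G)).
  by apply: sub_sigma_algebra; exists b.
move=> A mA; have sA : <<s G >> A.
  by have := mid measurableT A mA; rewrite setTI preimage_id.
apply: (g_sigma_algebra_measure_unique G _ (fun n => `]-oo, n%:R]%classic)) sA => //.
- by move=> _ [b _ <-]; exact: measurable_itv.
- by move=> n; exists n%:R.
- apply/seteqP; split=> // x _; exists (Num.truncn x).+1 => //=.
  by rewrite in_itv/= ltW// truncnS_gt.
- by move=> _ [b _ <-]; exact: PQ.
- by move=> n; apply: le_lt_trans (probability_le1 _ _) _ => //; rewrite ltry.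
Qed.

Section cancellation.
Context (R : realType) (E : completeNormedModType R) (sepE : separable E).
Context (mu : probability (borel E) R) (ws : weakly_stable mu).
Context (xi : E -> R) (cxi : cont_functional xi).
Implicit Types (lam kap : probability R R) (g : R -> R).

Let cosT := transform xi (@cos R).
Let sinT := transform xi (@sin R).

(** T_x mu and T_y mu have images under xi with the same characteristic
    function. *)
Definition same_scaled_transform x y := forall t : R,
  cosT mu (t * x) = cosT mu (t * y) /\ sinT mu (t * x) = sinT mu (t * y).

(** Iterating, f t = f (t r ^ n), and the argument tends to 0. *)
Lemma continuous_scaling_invariant (f : R -> R) r : continuous f -> `|r| < 1 ->
  (forall t, f t = f (t * r)) -> forall t, f t = f 0.
Proof.
move=> cf r1 fr t.
have fE n : f (t * r ^+ n) = f t.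
  by elim: n => [|n <-]; [rewrite expr0 mulr1|rewrite exprSr mulrA -fr].
have h : t * r ^+ n @[n --> \oo] --> (0 : R).
  by rewrite -[X in _ --> X](mulr0 t); apply: cvgM; [exact: cvg_cst|exact: cvg_expr].
have : f (t * r ^+ n) @[n --> \oo] --> f 0 by apply: cvg_comp; [exact: h|exact: cf].
under eq_fun do rewrite fE.
by move=> /(cvg_lim (@Rhausdorff R)) <-; rewrite lim_cst.
Qed.

Hypothesis nontrivial : ~ forall t, cosT mu t = 1 /\ sinT mu t = 0.

(** If |y| < |x|, the characteristic function is invariant under scaling by
    y / x, so it is constant, which nontriviality excludes. *)
Lemma same_scaled_transform_norm x y : same_scaled_transform x y -> `|x| = `|y|.
Proof.
wlog yx : x y / `|y| < `|x|.
  move=> wl xy; have [| |//] := ltrgtP `|y| `|x|.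
    by move=> yx; exact: wl.
  by move=> yx; apply/esym/wl => // t; have [-> ->] := xy t.
move=> xy; exfalso; apply: nontrivial.
have x0 : x != 0 by rewrite -normr_gt0; exact: le_lt_trans yx.
have r1 : `|y / x| < 1 by rewrite normrM normfV ltr_pdivrMr ?normr_gt0// mul1r.
have xyE t : cosT mu t = cosT mu (t * (y / x)) /\ sinT mu t = sinT mu (t * (y / x)).
  have := xy (t / x); rewrite divfK// => -[-> ->].
  by rewrite mulrAC mulrA.
move=> t; split.
  rewrite (@continuous_scaling_invariant (cosT mu) _ _ r1) => [||u].
  - exact: transform_cos0.
  - exact: (continuous_le1_transform cxi mu (continuous_le1_cos R)).1.
  - exact: (xyE u).1.
rewrite (@continuous_scaling_invariant (sinT mu) _ _ r1) => [||u].
- exact: transform_sin0.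
- exact: (continuous_le1_transform cxi mu (continuous_le1_sin R)).1.
- exact: (xyE u).2.
Qed.

(** For y = - x the sine transform would be equal to its opposite. *)
Lemma same_scaled_transform_eq x y : (exists t, sinT mu t != 0) ->
  same_scaled_transform x y -> x = y.
Proof.
move=> [t0 st0] xy; have xyn := same_scaled_transform_norm xy.
have [//|xNy] : x = y \/ x = - y.
  by move: xyn; do 2![case: ler0P => _]; [left|right|right|left]; lra.
have [y0|y0] := eqVneq y 0; first by rewrite xNy y0 oppr0.
have := (xy (t0 / y)).2; rewrite divfK// xNy mulrN divfK// /sinT (transform_sinN cxi).
by move=> h; move/negP: st0; case; apply/eqP; rewrite /sinT; lra.
Qed.

(** Rational arguments suffice by continuity, and a sequence of functions is
    what separated_itv_sigma takes; the codes that decode to nothing give a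
    harmless constant. *)
Definition probe (i : nat) : R -> R :=
  if unpickle i is Some (b, q) then
    fun s => transform xi (if b : bool then @cos R else @sin R) mu (ratr (q : rat) * s)
  else cst 0.

Lemma continuous_transform_scale g t : continuous_le1 g ->
  continuous ((fun s => transform xi g mu (t * s)) : R -> R).
Proof.
move=> cg s; apply: cvg_comp; last exact: (continuous_le1_transform cxi mu cg).1.
by apply: cvgM; [exact: cvg_cst|exact: cvg_id].
Qed.

Lemma continuous_le1_trig (b : bool) :
  continuous_le1 (if b then @cos R else @sin R).
Proof. by case: b; [exact: continuous_le1_cos|exact: continuous_le1_sin]. Qed.

Lemma continuous_probe i : continuous (probe i).
Proof.
rewrite /probe; case: unpickle => [[b q]|]; last exact: cst_continuous.
exact: continuous_transform_scale (continuous_le1_trig b).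
Qed.

Lemma same_scaled_transform_probe x y : (forall i, probe i x = probe i y) ->
  same_scaled_transform x y.
Proof.
move=> pxy.
suff H b t : transform xi (if b : bool then @cos R else @sin R) mu (t * x) =
    transform xi (if b : bool then @cos R else @sin R) mu (t * y).
  by move=> t; split; [exact: (H true)|exact: (H false)].
set g := if b then _ else _; have cg : continuous_le1 g := continuous_le1_trig b.
pose f t := transform xi g mu (t * x) - transform xi g mu (t * y).
have cf : continuous f.
  move=> u; apply: cvgB.
    by have := @continuous_transform_scale g x cg u; under eq_fun do rewrite mulrC.
  by have := @continuous_transform_scale g y cg u; under eq_fun do rewrite mulrC.
apply/eqP/contraT; rewrite -subr_eq0 => fne0.
have oU : open [set u | f u != 0].
  by apply: (@open_comp _ _ f [set u | u != 0]); [move=> u _; exact: cf|exact: open_neq].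
have [w [/= fw [q _ qw]]] := @dense_rat R _
  (ex_intro _ t (fne0 : [set u | f u != 0] t)) oU.
move: fw; rewrite -qw /f; have := pxy (pickle (b, q)); rewrite /probe pickleK -/g => ->.
by rewrite subrr eqxx.
Qed.

(** As functions of the scale, the transforms of all the mixtures. Weak
    stability is what makes their span an algebra. *)
Definition mixture_transforms : set (R -> R) := [set f | exists kap : probability R R,
  f = cosT (scale_mixture mu kap) \/ f = sinT (scale_mixture mu kap)].

Lemma cst1_mixture_transform : mixture_transforms (cst 1).
Proof.
exists (@dirac _ R 0 R); left; apply/funext => t.
rewrite /cosT (transform_mixture_dirac cxi _ _ _ (continuous_le1_cos R)) mulr0.
by rewrite transform_cos0.
Qed.

Lemma mixture_transforms_bounded : mixture_transforms `<=` bounded_mfun (T := R) (R := R).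
Proof.
move=> f [kap [->|->]]; apply: bounded_mfun_continuous_le1;
  apply: (continuous_le1_transform cxi).
  exact: continuous_le1_cos.
exact: continuous_le1_sin.
Qed.

(** The product of two transforms is obtained from the product-to-sum formulas,
    and weak stability turns the sum of two independent mixtures, and their
    difference, into mixtures again. The difference is the sum with k2 replaced
    by T_(-1) k2. *)
Lemma mixture_transforms_mul_closed : span_mul_closed (T := R) (mixture_transforms : set (R -> R)).
Proof.
move=> f g [k1 fE] [k2 gE].
have [k3 k3E] := ws k1 k2; have [k4 k4E] := ws k1 (scaleR (-1) k2).
have S (b : bool) (u v : R) k k' :
    lin_span (T := R) (mixture_transforms : set (R -> R)) (fun t =>
      u * transform xi (if b then @cos R else @sin R) (scale_mixture mu k) t +
      v * transform xi (if b then @cos R else @sin R) (scale_mixture mu k') t).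
  apply: spanD; apply: spanZ; apply: span_base.
    by exists k; case: b; [left|right].
  by exists k'; case: b; [left|right].
have c3 t := transform_cos_factor cxi t sepE k3E.
have s3 t := transform_sin_factor cxi t sepE k3E.
have c4 t := transform_cos_factor cxi t sepE k4E.
have s4 t := transform_sin_factor cxi t sepE k4E.
have cc := continuous_le1_cos R; have cs := continuous_le1_sin R.
have cN t : transform xi (@cos R) (scale_mixture mu (scaleR (-1) k2)) t =
    transform xi (@cos R) (scale_mixture mu k2) t.
  by rewrite (transform_scaleR cxi) // mulrN1 transform_cosN.
have sN t : transform xi (@sin R) (scale_mixture mu (scaleR (-1) k2)) t =
    - transform xi (@sin R) (scale_mixture mu k2) t.
  by rewrite (transform_scaleR cxi) // mulrN1 (transform_sinN cxi).
case: fE => ->; case: gE => ->.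
- have := S true 2^-1 2^-1 k3 k4.
  by congr (lin_span _ _); apply/funext => t; rewrite c3 c4 cN sN /cosT; field.
- have := S false 2^-1 (- 2^-1) k3 k4.
  by congr (lin_span _ _); apply/funext => t; rewrite s3 s4 cN sN /cosT /sinT; field.
- have := S false 2^-1 2^-1 k3 k4.
  by congr (lin_span _ _); apply/funext => t; rewrite s3 s4 cN sN /cosT /sinT; field.
- have := S true (- 2^-1) 2^-1 k3 k4.
  by congr (lin_span _ _); apply/funext => t; rewrite c3 c4 cN sN /sinT; field.
Qed.

Lemma separated_itv_mixture_transforms a b :
  (forall x y, ~ `[a, b]%classic x -> `[a, b]%classic y -> ~ same_scaled_transform x y) ->
  <<s negativity_sets (T := R) (mixture_transforms : set (R -> R)) >> `[a, b]%classic.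
Proof.
move=> sep; apply: (separated_itv_sigma (h := probe)).
- exact: continuous_probe.
- move=> i; rewrite /probe; case: unpickle => [[c q]|]; last exact: measurable_cst.
  apply: measurable_lin_span; first exact: cst1_mixture_transform.
  apply: span_base; exists (@dirac _ R (ratr q) R).
  have -> : (fun s => transform xi (if c then @cos R else @sin R) mu (ratr q * s)) =
      transform xi (if c then @cos R else @sin R) (scale_mixture mu (@dirac _ R (ratr q) R)).
    apply/funext => s; rewrite (transform_mixture_dirac cxi) 1?mulrC//.
    exact: continuous_le1_trig.
  by case: c; [left|right].
- move=> x y xab yab; apply: contrapT => pxy; apply: (sep x y) => //.
  by apply: same_scaled_transform_probe => i; apply: contrapT => /eqP pi; apply: pxy; exists i.
Qed.

Section same_transforms.
Variables lam lam' : probability R R.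
Hypothesis cE : forall t,
  cosT (scale_mixture mu lam) t = cosT (scale_mixture mu lam') t.
Hypothesis sE : forall t,
  sinT (scale_mixture mu lam) t = sinT (scale_mixture mu lam') t.

(** By the symmetry of the double integral, lam and lam' have the same integrals
    on all transforms of mixtures, so the monotone class theorem applies. *)
Lemma eq_sigma_mixture_transforms (U : set R) :
  <<s negativity_sets (T := R) (mixture_transforms : set (R -> R)) >> U -> lam U = lam' U.
Proof.
apply: (eq_measure_lin_span (T := R) mixture_transforms_bounded cst1_mixture_transform
  mixture_transforms_mul_closed) => f [kap [->|->]].
- rewrite /cosT (Rintegral_transform_swap cxi _ _ _ (continuous_le1_cos R)).
  rewrite [RHS](Rintegral_transform_swap cxi _ _ _ (continuous_le1_cos R)).
  by apply: eq_Rintegral => t _; exact: cE.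
- rewrite /sinT (Rintegral_transform_swap cxi _ _ _ (continuous_le1_sin R)).
  rewrite [RHS](Rintegral_transform_swap cxi _ _ _ (continuous_le1_sin R)).
  by apply: eq_Rintegral => t _; exact: sE.
Qed.

(** Scales of distinct absolute values are always separated, so the symmetric
    intervals [-b, b] are recovered. *)
Lemma eq_abs_law : abs_law lam ≡ abs_law lam'.
Proof.
apply: eq_measure_itvNyc => b.
have normE : (@Num.norm R R) @^-1` `]-oo, b]%classic = `[- b, b]%classic.
  by apply/seteqP; split => x /=; rewrite !in_itv/= ler_norml.
have absE (l : probability R R) : abs_law l `]-oo, b]%classic = l `[- b, b]%classic.
  by rewrite -normE.
rewrite !absE; apply: eq_sigma_mixture_transforms.
apply: separated_itv_mixture_transforms => x y xb yb /same_scaled_transform_norm xy.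
apply: xb; move: yb.
by rewrite /= !in_itv/= -!ler_norml xy.
Qed.

(** A nonzero sine transform separates all distinct scales, so all compact
    intervals are recovered. *)
Lemma eq_law_of_asymmetric : (exists t, sinT mu t != 0) -> lam ≡ lam'.
Proof.
move=> st; apply: eq_measure_itvNyc => b; apply: eq_sigma_mixture_transforms.
have -> : `]-oo, b]%classic = \bigcup_n `[b - n%:R, b]%classic.
  apply/seteqP; split => [x|x [n _]] /=; rewrite !in_itv/=.
    move=> xb; exists (Num.truncn (b - x)).+1 => //=.
    rewrite in_itv/= xb andbT lerBlDr -lerBlDl ltW//.
    by rewrite truncnS_gt.
  by move=> /andP[].
apply: (@bigcupT_measurable _ (g_sigma_algebraType _)) => n.
apply: separated_itv_mixture_transforms => x y xab yab xy; apply: xab.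
by rewrite (same_scaled_transform_eq st xy).
Qed.

End same_transforms.

End cancellation.

(** * Folding and the choice of a functional *)
Section folding.
Context (R : realType) (E : completeNormedModType R).
Implicit Types (mu : probability (borel E) R) (lam : probability R R) (xi : E -> R).

Lemma transform_scale g mu xi a t : cont_functional xi -> continuous_le1 g ->
  transform xi g (scale mu a) t = transform xi g mu (t * a).
Proof.
move=> cxi cg; rewrite /transform /scale Rintegral_law; last exact: bounded_mfun_comp_functional.
by apply: eq_Rintegral => x _; rewrite (functionalZ _ _ cxi) mulrA.
Qed.

Lemma transform_sin_symmetric mu xi t : cont_functional xi -> symmetric_law mu ->
  transform xi (@sin R) mu t = 0.
Proof.
move=> cxi sym.
have h : transform xi (@sin R) mu t = - transform xi (@sin R) mu t.
  rewrite -[LHS](eq_measure_Rintegral _ sym).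
  have := transform_scale mu (-1) t cxi (continuous_le1_sin R).
  by rewrite mulrN1 (transform_sinN cxi).
by lra.
Qed.

(** Folding replaces s by |s| in the mixture; the cosine transform is even, and
    for a symmetric mu the sine transform vanishes. *)
Lemma transform_cos_fold mu lam xi t : cont_functional xi ->
  transform xi (@cos R) (scale_mixture mu (fold_law mu lam)) t =
  transform xi (@cos R) (scale_mixture mu lam) t.
Proof.
move=> cxi; have cc := continuous_le1_cos R.
rewrite /fold_law; case: pselect => //= _.
rewrite /abs_law (transform_mixture_law cxi)// (transform_mixture cxi)//.
apply: eq_Rintegral => s _; case: ler0P => // _.
by rewrite mulrN transform_cosN.
Qed.

Lemma transform_sin_fold mu lam xi t : cont_functional xi ->
  transform xi (@sin R) (scale_mixture mu (fold_law mu lam)) t =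
  transform xi (@sin R) (scale_mixture mu lam) t.
Proof.
move=> cxi; have cs := continuous_le1_sin R.
rewrite /fold_law; case: pselect => //= sym.
rewrite /abs_law (transform_mixture_law cxi)// (transform_mixture cxi)//.
by apply: eq_Rintegral => s _; rewrite !transform_sin_symmetric.
Qed.

(** A functional whose image of mu is not concentrated at 0, and which detects
    the asymmetry of mu if there is one. The cancellation argument takes place
    on a single such functional. *)
Definition resolving mu xi :=
  (~ forall t, transform xi (@cos R) mu t = 1 /\ transform xi (@sin R) mu t = 0) /\
  (~ symmetric_law mu -> exists t, transform xi (@sin R) mu t != 0).

(** If no functional did, mu would have the characteristic functional of the
    Dirac mass at 0, or of its own reflection. *)
Lemma exists_resolving_functional mu : separable E ->
  ~ (mu ≡ @dirac _ (borel E) (0 : E) R) ->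
  exists xi, cont_functional xi /\ resolving mu xi.
Proof.
move=> sepE mu0.
have bw (g : R -> R) (xi : E -> R) : continuous_le1 g -> cont_functional xi ->
    bounded_mfun (T := borel E) (fun x : borel E => g (xi x)).
  move=> cg cxi; have := bounded_mfun_comp_functional cxi 1 cg.
  by under eq_fun do rewrite mul1r.
have tE (g : R -> R) xi (m : probability (borel E) R) : transform xi g m 1 = \int[m]_x g (xi x).
  by apply: eq_Rintegral => x _; rewrite mul1r.
have cc := continuous_le1_cos R; have cs := continuous_le1_sin R.
have [sym|asym] := pselect (symmetric_law mu).
  apply: contrapT => none; apply: mu0.
  apply: (eq_measure_char_functional sepE) => xi cxi.
  have x0 : xi 0 = 0 by rewrite -(scale0r (0 : E)) (functionalZ _ _ cxi) mul0r.
  have [c1 s0] : transform xi (@cos R) mu 1 = 1 /\ transform xi (@sin R) mu 1 = 0.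
    by apply: contrapT => h; apply: none; exists xi; split=> //; split=> // /(_ 1).
  split.
  - rewrite -(tE (@cos R)) c1 /Rintegral integral_dirac//=.
      by rewrite indicT x0 cos0 mul1r.
    by apply/measurable_EFinP; have [] := bw _ _ cc cxi.
  - rewrite -(tE (@sin R)) s0 /Rintegral integral_dirac//=.
      by rewrite indicT x0 sin0 mulr0.
    by apply/measurable_EFinP; have [] := bw _ _ cs cxi.
have [xi [cxi st]] : exists xi, cont_functional xi /\ transform xi (@sin R) mu 1 != 0.
  apply: contrapT => none; apply: asym.
  apply: (eq_measure_char_functional sepE) => xi cxi.
  have s0 : transform xi (@sin R) mu 1 = 0.
    by apply: contrapT => /eqP h; apply: none; exists xi.
  split; rewrite -?(tE (@cos R)) -?(tE (@sin R)) transform_scale// mulrN1.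
    by rewrite transform_cosN.
  by rewrite (transform_sinN cxi) s0 oppr0.
exists xi; split=> //; split; last by move=> _; exists 1.
by move=> /(_ 1)[_ s0]; rewrite s0 eqxx in st.
Qed.

Lemma eq_fold_law mu (ws : weakly_stable mu) xi lam lam' : separable E ->
  cont_functional xi -> resolving mu xi ->
  (forall t, transform xi (@cos R) (scale_mixture mu lam) t =
             transform xi (@cos R) (scale_mixture mu lam') t) ->
  (forall t, transform xi (@sin R) (scale_mixture mu lam) t =
             transform xi (@sin R) (scale_mixture mu lam') t) ->
  fold_law mu lam ≡ fold_law mu lam'.
Proof.
move=> sepE cxi [nt st] cE sE; rewrite /fold_law; case: pselect => [sym|asym].
  exact: (eq_abs_law sepE ws cxi nt cE sE).
exact: (eq_law_of_asymmetric sepE ws cxi nt cE sE (st asym)).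
Qed.

End folding.

Theorem lemma1 (R : realType) (E : completeNormedModType R)
    (sepE : separable E) (mu : probability (borel E) R)
    (ws : weakly_stable mu) (mu_neq0 : ~ (mu ≡ @dirac _ (borel E) (0 : E) R)) :
  (forall lam1 lam2 lam lam' : probability R R,
     mixture_factor mu lam1 lam2 lam -> mixture_factor mu lam1 lam2 lam' ->
     fold_law mu lam ≡ fold_law mu lam')
  /\
  (forall lam1 lam2 : probability R R,
     fold_law mu (gconv ws lam1 lam2) ≡ fold_law mu (gconv ws lam2 lam1))
  /\
  (forall lam : probability R R,
     fold_law mu (gconv ws lam (@dirac _ R (0 : R) R)) ≡ fold_law mu lam)
  /\
  (forall lam1 lam2 lam3 : probability R R,
     fold_law mu (gconv ws (gconv ws lam1 lam2) lam3)
       ≡ fold_law mu (gconv ws lam1 (gconv ws lam2 lam3)))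
  /\
  (forall (a : R) (lam1 lam2 : probability R R),
     fold_law mu (scaleR a (gconv ws lam1 lam2))
       ≡ fold_law mu (gconv ws (scaleR a lam1) (scaleR a lam2))).
Proof.
have [xi [cxi rxi]] := exists_resolving_functional sepE mu_neq0.
have cc := continuous_le1_cos R; have cs := continuous_le1_sin R.
pose C lam t := transform xi (@cos R) (scale_mixture mu lam) t.
pose S lam t := transform xi (@sin R) (scale_mixture mu lam) t.
have eqCS lam lam' : (forall t, C lam t = C lam' t) -> (forall t, S lam t = S lam' t) ->
    fold_law mu lam ≡ fold_law mu lam' := eq_fold_law ws sepE cxi rxi.
have gC lam1 lam2 t : C (gconv ws lam1 lam2) t = C lam1 t * C lam2 t - S lam1 t * S lam2 t.
  rewrite /C /gconv (transform_cos_fold _ _ _ cxi).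
  exact: (transform_cos_factor cxi t sepE (projT2 (cid (ws lam1 lam2)))).
have gS lam1 lam2 t : S (gconv ws lam1 lam2) t = S lam1 t * C lam2 t + C lam1 t * S lam2 t.
  rewrite /S /gconv (transform_sin_fold _ _ _ cxi).
  exact: (transform_sin_factor cxi t sepE (projT2 (cid (ws lam1 lam2)))).
have aC a lam t : C (scaleR a lam) t = C lam (t * a) := transform_scaleR cxi mu a lam t cc.
have aS a lam t : S (scaleR a lam) t = S lam (t * a) := transform_scaleR cxi mu a lam t cs.
have C0 t : C (@dirac _ R (0 : R) R) t = 1.
  by rewrite /C (transform_mixture_dirac cxi)// mulr0 transform_cos0.
have S0 t : S (@dirac _ R (0 : R) R) t = 0.
  by rewrite /S (transform_mixture_dirac cxi)// mulr0 transform_sin0.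
split=> [lam1 lam2 lam lam' lamE lamE'|].
  apply: eqCS => t.
    by rewrite /C (transform_cos_factor cxi t sepE lamE)
      (transform_cos_factor cxi t sepE lamE').
  by rewrite /S (transform_sin_factor cxi t sepE lamE)
    (transform_sin_factor cxi t sepE lamE').
split=> [lam1 lam2|]; first by apply: eqCS => t; rewrite ?gC ?gS; ring.
split=> [lam|]; first by apply: eqCS => t; rewrite ?gC ?gS C0 S0; ring.
split=> [lam1 lam2 lam3|a lam1 lam2]; apply: eqCS => t.
- by rewrite !gC !gS; ring.
- by rewrite !(gS, gC); ring.
- by rewrite aC !gC !aC !aS.
- by rewrite aS !gS !aC !aS.
Qed.
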